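(* Let $S$ be a finite set with an action of a finite group $G$, and let $\mathcal{O}(S)$ denote its set of $G$--orbits. For each orbit $\mathfrak{o}\in\mathcal{O}(S)$, pick a representative $s_\mathfrak{o}\in\mathfrak{o}$ and let $G_\mathfrak{o}$ be the stabilizer of $s_\mathfrak{o}$ in $G$. For $(\widetilde{\beta},z_\beta)\in\mathcal{D}_n(G,S)$, we have \[ \mathcal{D}_n(G,S)_{\leq(\widetilde{\beta},z_\beta)}\cong \prod_{B\in\beta} \Pi_{B} \times \prod_{\mathfrak{o}\in\mathcal{O}(S)} \mathcal{D}_{z_{\beta}^{-1}(\mathfrak{o})}(G_\mathfrak{o}) \] and \[ \mathcal{D}_n(G,S)_{\geq(\widetilde{\beta},z_\beta)} \cong \mathcal{D}_{\beta}(G,S). \] Furthermore, if $(\widetilde{\alpha},z_\alpha)\leq(\widetilde{\beta},z_\beta)$, then \[ [(\widetilde{\alpha},z_\alpha),(\widetilde{\beta},z_\beta)] \cong \prod_{B\in\beta} \Pi_{p_B} \times \prod_{\mathfrak{o}\in\mathcal{O}(S)} \mathcal{D}_{r_\mathfrak{o}}(G_\mathfrak{o}), \] where $p_B$ is the set of blocks $\widetilde{A}\in\widetilde{\alpha}$ for which $A\subseteq B$ and $r_\mathfrak{o}$ is the set of blocks $\widetilde{A}\in\widetilde{\alpha}$ for which $A\subseteq z_{\beta}^{-1}(\mathfrak{o})$. In particular, every closed interval is a geometric lattice.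
   Context: Let $G$ be a finite group acting on a finite set $S$, and let $[n]=\{1,\dots,n\}$ (more generally any finite set $\tau$ may serve as base set). A projectivized $G$-coloring of a finite set $B$ is a function $b:B\to G$ up to the equivalence $b\sim bg$ for $g\in G$; its class is written $\widetilde{B}$. A partial $G$-partition $\widetilde{\beta}$ of $\tau$ is a partition $\beta$ of a subset of $\tau$ into blocks, each equipped with a projectivized $G$-coloring; its zero block is $Z=\tau\setminus\bigcup_{B\in\beta}B$. The $S$--Dowling poset $\mathcal{D}_\tau(G,S)$ (written $\mathcal{D}_n(G,S)$ when $\tau=[n]$) is the set of pairs $(\widetilde{\beta},z)$ with $\widetilde{\beta}$ a partial $G$-partition of $\tau$ and $z:Z\to S$ a function on its zero block, ordered via the covering relations: (merge) $(\widetilde{\beta}\cup\{\widetilde{A},\widetilde{B}\},z)\prec(\widetilde{\beta}\cup\{\widetilde{C}\},z)$ where $C=A\cup B$ with coloring $c=a\cup bg$ for some $g\in G$; and (color) $(\widetilde{\beta}\cup\{\widetilde{B}\},z)\prec(\widetilde{\beta},z')$ where $z'$ extends $z$ to $B\cup Z$ by $z'|_B=f\circ b$ for some $G$-equivariant $f:G\to S$. It is ranked with rank $|\tau|-\ell(\beta)$, $\ell(\beta)$ the number of blocks. For a finite set $\tau$, $\Pi_\tau$ denotes the lattice of set partitions of $\tau$, and for a group $H$, $\mathcal{D}_\tau(H)$ denotes the Dowling lattice of partial $H$-partitions of $\tau$ (equivalently $\mathcal{D}_\tau(H,S)$ with $S$ a single point). Note the base sets in the upper-interval and interval formulas are sets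 of blocks rather than subsets of $[n]$. *)

(* Defs.v *)
From HB Require Import structures.
From mathcomp Require Import all_boot all_order all_fingroup.

Set Implicit Arguments.
Unset Strict Implicit.
Unset Printing Implicit Defensive.

Import Order.Theory.
Import GroupScope.

Local Open Scope order_scope.

Definition order_iso d (P : porderType d) d' (Q : porderType d') : Prop :=
  exists f : P -> Q, bijective f /\ {mono f : x y / x <= y}.

Section Intervals.
Variables (d : Order.disp_t) (P : porderType d).

Definition downset (y : P) := {x : P | x <= y}.
HB.instance Definition _ y := SubChoice.on (downset y).
HB.instance Definition _ y :=
  [SubChoice_isSubPOrder of downset y by <: with d].

Definition upset (y : P) := {x : P | y <= x}.
HB.instance Definition _ y := SubChoice.on (upset y).
HB.instance Definition _ y :=
  [SubChoice_isSubPOrder of upset y by <: with d].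

Definition segment (x y : P) := {z : P | x <= z <= y}.
HB.instance Definition _ x y := SubChoice.on (segment x y).
HB.instance Definition _ x y :=
  [SubChoice_isSubPOrder of segment x y by <: with d].

End Intervals.

Fact fprod_poset_display : Order.disp_t. Proof. exact: Order.Disp tt tt. Qed.

Section DependentProduct.
Variables (I : finType) (d : Order.disp_t) (F : I -> porderType d).

Definition fprod_poset := {dffun forall i : I, F i}.
HB.instance Definition _ := Choice.on fprod_poset.

Definition fprod_poset_le (f g : fprod_poset) := [forall i, f i <= g i].

Fact fprod_poset_le_refl : reflexive fprod_poset_le.
Proof. by move=> f; apply/forallP. Qed.

Fact fprod_poset_le_anti : antisymmetric fprod_poset_le.
Proof.
move=> f g /andP[/forallP fg /forallP gf].
by apply/ffunP => i; apply: le_anti; rewrite fg gf.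
Qed.

Fact fprod_poset_le_trans : transitive fprod_poset_le.
Proof.
move=> g f h /forallP fg /forallP gh.
by apply/forallP => i; apply: le_trans (fg i) (gh i).
Qed.

HB.instance Definition _ :=
  Order.Le_isPOrder.Build fprod_poset_display fprod_poset
    fprod_poset_le_refl fprod_poset_le_anti fprod_poset_le_trans.

End DependentProduct.

Section GeometricLattice.
Variables (d : Order.disp_t) (L : finTBLatticeType d).

Definition covered_by (x y : L) :=
  (x < y) && ~~ [exists z : L, (x < z) && (z < y)].

Definition atomistic : Prop :=
  forall x : L, x = \join_(a : L | covered_by \bot a && (a <= x)) a.

(* Graded by a submodular rank function. *)
Definition semimodular : Prop :=
  exists rk : L -> nat,
    [/\ rk \bot = 0%N,
        forall x y, covered_by x y -> rk y = (rk x).+1 &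
        forall x y, (rk (x `&` y) + rk (x `|` y) <= rk x + rk y)%N].

End GeometricLattice.

Definition geometric_lattice d (P : porderType d) : Prop :=
  exists d' (L : finTBLatticeType d'),
    [/\ order_iso P L, semimodular L & atomistic L].

Fact setpart_display : Order.disp_t. Proof. exact: Order.Disp tt tt. Qed.

(* The lattice Pi_A, ordered so that merging blocks goes up. *)
Section SetPartitions.
Variables (T : finType) (A : {set T}).

Definition setpart := {P : {set {set T}} | partition P A}.
HB.instance Definition _ := Finite.on setpart.

Definition setpart_le (P Q : setpart) :=
  [forall B in val P, exists C in val Q, B \subset C].

Fact setpart_le_refl : reflexive setpart_le.
Proof.
by move=> P; apply/forall_inP => B PB; apply/exists_inP; exists B.
Qed.

Fact setpart_le_trans : transitive setpart_le.
Proof.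
move=> Q P R /forall_inP PQ /forall_inP QR; apply/forall_inP => B PB.
have /exists_inP[C QC BC] := PQ B PB; have /exists_inP[D RD CD] := QR C QC.
by apply/exists_inP; exists D => //; apply: subset_trans BC CD.
Qed.

Fact setpart_le_anti : antisymmetric setpart_le.
Proof.
suff sub (P Q : setpart) :
    setpart_le P Q -> setpart_le Q P -> val P \subset val Q.
  by move=> P Q /andP[PQ QP]; apply/val_inj/eqP; rewrite eqEsubset !sub.
move=> /forall_inP PQ /forall_inP QP; apply/subsetP => B PB.
have /exists_inP[C QC BC] := PQ B PB; have /exists_inP[D PD CD] := QP C QC.
have /and3P[_ /trivIsetP tP P0] := valP P.
have DB : D = B.
  apply/eqP/idPn => neqDB; have /= dDB := tP D B PD PB neqDB.
  have B0 : B = set0.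
    apply/eqP; rewrite -subset0 -(setIid B).
    have BD := subset_trans BC CD.
    by rewrite -(disjoint_setI0 dDB) setSI.
  by move: P0; rewrite -B0 PB.
by rewrite (_ : B = C) //; apply/eqP; rewrite eqEsubset BC -DB.
Qed.

HB.instance Definition _ := Order.Le_isPOrder.Build setpart_display setpart
  setpart_le_refl setpart_le_anti setpart_le_trans.

End SetPartitions.

(* A function B -> X on a subset B of T is encoded as an option-valued finite
   function on T with domain B. *)
Section PartialFunctions.
Variables (T : finType) (X : eqType).

Definition pdom (f : {ffun T -> option X}) : {set T} :=
  [set x | f x != None].

Definition punion (f g : {ffun T -> option X}) : {ffun T -> option X} :=
  [ffun x => if f x is Some u then Some u else g x].

End PartialFunctions.

Section ProjectivizedColorings.
Variables (T : finType) (gT : finGroupType).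

Definition coloring := {ffun T -> option gT}.
HB.instance Definition _ := Finite.on coloring.

Definition rshift (b : coloring) (g : gT) : coloring :=
  [ffun x => omap (fun h => h * g) (b x)].

(* A projectivized coloring is the set of all its representatives. *)
Definition pclass (b : coloring) : {set coloring} := [set rshift b g | g : gT].

Definition underlying (bt : {set coloring}) : {set T} :=
  \bigcup_(b in bt) pdom b.

Definition underlying_blocks (beta : {set {set coloring}}) : {set {set T}} :=
  [set underlying bt | bt in beta].

Definition partial_partition (tau : {set T}) (beta : {set {set coloring}}) :=
  let P := underlying_blocks beta in
  [&& [forall bt in beta, exists b, bt == pclass b],
      dinjectiveb underlying (mem beta),
      partition P (cover P) &
      cover P \subset tau].

End ProjectivizedColorings.

Fact dowling_display : Order.disp_t. Proof. exact: Order.Disp tt tt. Qed.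

Section LeftAction.
Variables (gT : finGroupType) (S : finType) (to : {action gT &-> S}).

(* Library actions are right actions; this is the associated left action
   (every left action arises in this way, with the same orbits and
   stabilizers). *)
Definition lact (g : gT) (s : S) : S := to s g^-1.

Definition equivariant (f : {ffun gT -> S}) :=
  [forall g, forall h, f (g * h) == lact g (f h)].

Definition orbits : {set {set S}} := orbit to [set: gT] @: [set: S].

End LeftAction.

Section DowlingPoset.
Variables (gT : finGroupType) (S : finType).

Definition dowling_axiom (T : finType) (tau : {set T})
    (x : {set {set coloring T gT}} * {ffun T -> option S}) :=
  partial_partition tau x.1 &&
  (pdom x.2 == tau :\: cover (underlying_blocks x.1)).

(* The action is used only by the order on this type. *)
Record dowling (to : {action gT &-> S}) (T : finType) (tau : {set T}) :
    predArgType := Dowling {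
  dowling_val : {set {set coloring T gT}} * {ffun T -> option S};
  _ : dowling_axiom tau dowling_val
}.

Variables (to : {action gT &-> S}) (T : finType) (tau : {set T}).

HB.instance Definition _ := [isSub for @dowling_val to T tau].
HB.instance Definition _ := [Finite of dowling to tau by <:].

Implicit Types x y : dowling to tau.

Definition blocks x : {set {set coloring T gT}} := (val x).1.

Definition zero_coloring x : {ffun T -> option S} := (val x).2.

Definition underlying_partition x : {set {set T}} :=
  underlying_blocks (blocks x).

Definition zero_preim x (o : {set S}) : {set T} :=
  [set i | if zero_coloring x i is Some s then s \in o else false].

Definition dowling_merge x y :=
  [exists a : coloring T gT, exists b : coloring T gT, exists g : gT,
    [&& pclass a \in blocks x, pclass b \in blocks x, pclass a != pclass b,
        blocks y == pclass (punion a (rshift b g))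
                      |: (blocks x :\: [set pclass a; pclass b]) &
        zero_coloring y == zero_coloring x]].

Definition dowling_color x y :=
  [exists b : coloring T gT, exists f : {ffun gT -> S},
    [&& equivariant to f, pclass b \in blocks x,
        blocks y == blocks x :\ pclass b &
        zero_coloring y ==
          punion (zero_coloring x) [ffun i => omap f (b i)]]].

Definition dowling_cover x y :=
  dowling_merge x y || dowling_color x y.

Definition dowling_le : rel (dowling to tau) := connect dowling_cover.

Lemma dowling_cover_card x y :
  dowling_cover x y -> (#|blocks y| < #|blocks x|)%N.
Proof.
case/orP => [/existsP[a /existsP[b /existsP[g /and5P[xa xb ab /eqP-> _]]]]|].
  have sub : [set pclass a; pclass b] \subset blocks x.
    by apply/subsetP => c /set2P[]->.
  have := cardsD (blocks x) [set pclass a; pclass b].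
  have := subset_leq_card sub.
  rewrite (setIidPr sub) cards2 ab cardsU1 => le2 ->.
  apply: leq_ltn_trans (leq_add (leq_b1 _) (leqnn _)) _.
  by rewrite add1n -subSn // ltn_subLR // leqW.
case/existsP => b /existsP[f /and4P[_ xb /eqP-> _]].
by rewrite [X in (_ < X)%N](cardsD1 (pclass b)) xb.
Qed.

Fact dowling_le_refl : reflexive dowling_le.
Proof. exact: connect0. Qed.

Fact dowling_le_trans : transitive dowling_le.
Proof. exact: connect_trans. Qed.

Lemma dowling_le_card x y :
  dowling_le x y -> x = y \/ (#|blocks y| < #|blocks x|)%N.
Proof.
case/connectP => p; elim: p x => [|z p IHp] x /=; first by left.
case/andP => /dowling_cover_card xz zp yE; right.
by have [<-//|yz] := IHp z zp yE; apply: ltn_trans yz xz.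
Qed.

Fact dowling_le_anti : antisymmetric dowling_le.
Proof.
move=> x y /andP[/dowling_le_card[//|xy] /dowling_le_card[//|yx]].
by have := ltn_trans xy yx; rewrite ltnn.
Qed.

HB.instance Definition _ :=
  Order.Le_isPOrder.Build dowling_display (dowling to tau)
    dowling_le_refl dowling_le_anti dowling_le_trans.

End DowlingPoset.

Section DowlingLattice.
Variable gT : finGroupType.

Definition unit_act (u : unit) (_ : gT) := u.

Definition unit_action : {action gT &-> unit} :=
  TotalAction (to := unit_act) (fun _ => erefl) (fun _ _ _ => erefl).

(* With S a point, the coloring of the zero block carries no information, and
   an element is just a partial G-partition. *)
Definition dowling_lattice (T : finType) (tau : {set T}) :=
  dowling unit_action tau.
End DowlingLattice.

Arguments dowling_lattice gT {T} tau.

(* Main.v *)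
(* An element (beta, z) is encoded by the set of its valid "data": the triples
   (i, g, j) such that i and j lie in a block colored by b with b i = g * b j, or
   both lie in the zero block with z i = g . z j, and the pairs (i, t) with
   z i = t. Equivalently, this is a G-invariant equivalence relation on
   (tau x G) + S which is trivial on S and in which (i, 1) and (i, g) may be
   related for g <> 1 only if i is related to a point of S. Under this encoding
   the order becomes inclusion, since any datum of y missing from x <= y can be
   acquired by a single merge or color step below y.

   Upper intervals: choosing a base point in each block of x, the relations
   containing that of x are determined by their restriction to base points.
   Lower intervals: a relation contained in that of y is the same as an
   equivalence relation on each block of y together with, for each orbit o, a
   relation on the points colored in o; dividing out an element of G carrying
   s o to the color of each point, the gains of the latter lie in the stabilizer
   of s o. Intervals combine both.

   Geometricity: below y, meets are intersections, and joining an atom costs at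
   most one merge or color step. *)

Require Import Defs.
From HB Require Import structures.
From mathcomp Require Import all_boot all_order all_fingroup.
Import Order.Theory GroupScope.
Local Open Scope order_scope.
Set Implicit Arguments.
Unset Strict Implicit.
Unset Printing Implicit Defensive.

(* [fintype.rshift] shadows the right shift of colorings. *)
Local Notation rshift := Defs.rshift.
Local Notation datum gT S T := ((T * gT * T) + (T * S))%type.
Local Notation arc i g j := (inl (i, g, j)).
Local Notation hue i s := (inr (i, s)).

(** * Colorings and elements of the Dowling poset *)

Section Colorings.
Variables (T : finType) (gT : finGroupType).
Implicit Types (a b c : coloring T gT) (i j : T) (g h : gT).

Lemma rshift1 b : rshift b 1 = b.
Proof. by apply/ffunP => i; rewrite ffunE; case: (b i) => //= h; rewrite mulg1. Qed.

Lemma rshiftM b g h : rshift (rshift b g) h = rshift b (g * h).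
Proof. by apply/ffunP => i; rewrite !ffunE; case: (b i) => //= k; rewrite mulgA. Qed.

Lemma pclassP b c : reflect (exists g, c = rshift b g) (c \in pclass b).
Proof. by apply: (iffP imsetP) => [[g _ ->]|[g ->]]; exists g. Qed.

Lemma pclass_refl b : b \in pclass b.
Proof. by apply/pclassP; exists 1; rewrite rshift1. Qed.

Lemma pclass_rshift b g : pclass (rshift b g) = pclass b.
Proof.
apply/setP => c; apply/pclassP/pclassP => -[h ->].
  by exists (g * h); rewrite rshiftM.
by exists (g^-1 * h); rewrite rshiftM mulKVg.
Qed.

Lemma in_pdom (X : eqType) (f : {ffun T -> option X}) i :
  (i \in pdom f) = isSome (f i).
Proof. by rewrite inE; case: (f i). Qed.

Lemma isSome_rshift b g i : isSome (rshift b g i) = isSome (b i).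
Proof. by rewrite ffunE; case: (b i). Qed.

Lemma underlying_pclass b : underlying (pclass b) = pdom b.
Proof.
apply/setP => i; apply/bigcupP/idP => [[c /pclassP[g ->]]|bi].
  by rewrite !in_pdom isSome_rshift.
by exists b; first exact: pclass_refl.
Qed.

End Colorings.

(** * Pointwise description of the elements *)

Section Atlas.
Variables (gT : finGroupType) (S : finType) (T : finType) (tau : {set T}).
Implicit Types (a b c : coloring T gT) (i j : T) (g h : gT).
Implicit Types (beta : {set {set coloring T gT}}) (z : {ffun T -> option S}).

(** The axiom of the poset, rephrased for representatives [b] and points [i]. In this form a newly
    built pair can be checked without handling sets of colorings. *)
Record atlas beta z : Prop := Atlas {
  atlas_class : forall bt, bt \in beta -> exists b, bt = pclass b;
  atlas_point : forall b, pclass b \in beta -> exists i, b i;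
  atlas_eq : forall b c i, pclass b \in beta -> pclass c \in beta ->
    b i -> c i -> pclass b = pclass c;
  atlas_base : forall b i, pclass b \in beta -> b i -> i \in tau;
  atlas_nonzero : forall b i, pclass b \in beta -> b i -> z i = None;
  atlas_cover : forall i, i \in tau -> z i = None ->
    exists2 b, pclass b \in beta & b i;
  atlas_zero : forall i, z i -> i \in tau }.

Lemma dowling_axiomP beta z :
  dowling_axiom tau (beta, z) <-> atlas beta z.
Proof.
set P := underlying_blocks beta.
have inP b : pclass b \in beta -> pdom b \in P.
  by move=> bb; apply/imsetP; exists (pclass b); rewrite ?underlying_pclass.
split=> [/andP[/and4P[/forall_inP cl /dinjectiveP inj partP covt] /eqP/= domz]|].
  have /and3P[_ trivP P0] := partP.
  have class bt : bt \in beta -> exists b, bt = pclass b.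
    by move=> /cl/existsP[b /eqP->]; exists b.
  have zi i : isSome (z i) = (i \in tau) && (i \notin cover P).
    by rewrite -in_pdom domz inE andbC.
  have cov b i : pclass b \in beta -> b i -> i \in cover P.
    move=> bb bi; apply/bigcupP; exists (pdom b); first exact: inP.
    by rewrite in_pdom.
  split=> //.
  - move=> b bb; have /set0Pn[i] : pdom b != set0.
      by apply: contraNneq P0 => <-; apply: inP.
    by rewrite in_pdom => ?; exists i.
  (* Blocks of a partition that share a point are equal, and [underlying] is injective on [beta]. *)
  - move=> b c i bb cb bi ci; apply: inj => //; rewrite !underlying_pclass.
    apply/eqP/idPn => neq.
    have := trivIsetP trivP _ _ (inP _ bb) (inP _ cb) neq.
    by move=> /disjoint_setI0/setP/(_ i); rewrite in_setI !in_pdom bi ci inE.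
  - by move=> b i bb bi; apply: (subsetP covt); apply: cov bb bi.
  - move=> b i bb bi; have := zi i; rewrite (cov b) // andbF.
    by case: (z i).
  - move=> i it zN; have := zi i; rewrite zN it /= => /esym/negbFE.
    case/bigcupP => _ /imsetP[bt btb ->]; have [b btE] := class bt btb.
    by rewrite btE underlying_pclass in_pdom => bi; exists b; rewrite -?btE.
  - by move=> i; rewrite zi => /andP[].
case=> class point eqc base nz cov zt; apply/andP; split; last first.
  rewrite /=; apply/eqP/setP => i; rewrite in_pdom inE.
  apply/idP/andP => [zi|[ni it]].
    split; last exact: zt.
    apply/negP => /bigcupP[_ /imsetP[bt btb ->]]; have [b btE] := class bt btb.
    rewrite btE underlying_pclass in_pdom => /nz zN.
    by move: zi; rewrite zN // -btE.
  case zE: (z i) => //; have [b bb bi] := cov i it zE; case/negP: ni.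
  by apply/bigcupP; exists (pdom b); rewrite ?inP ?in_pdom.
apply/and4P; split=> //=.
- by apply/forall_inP => bt /class[b ->]; apply/existsP; exists b.
- apply/dinjectiveP => _ _ /[dup]/class[b ->] bb /[dup]/class[c ->] cb.
  rewrite !underlying_pclass => bc; have [i bi] := point b bb.
  by apply: (eqc b c i) => //; rewrite -in_pdom -bc in_pdom.
- apply/and3P; split=> //.
    apply/trivIsetP => _ _ /imsetP[bt + ->] /imsetP[ct + ->].
    move=> /[dup]/class[b ->] bb /[dup]/class[c ->] cb; apply: contraR.
    rewrite -setI_eq0 => /set0Pn[i]; rewrite !underlying_pclass inE !in_pdom.
    by move=> /andP[bi ci]; rewrite -!underlying_pclass (eqc b c i).
  apply/negP => /imsetP[bt /[dup]/class[b ->] bb].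
  rewrite underlying_pclass => b0; have [i] := point b bb.
  by rewrite -in_pdom -b0 inE.
apply/bigcupsP => _ /imsetP[bt /[dup]/class[b ->] bb ->].
rewrite underlying_pclass; apply/subsetP => i; rewrite in_pdom.
exact: base.
Qed.

End Atlas.

Lemma ffun_option_ext (T : finType) (X : eqType) (f g : {ffun T -> option X}) :
  (forall i u, (f i == Some u) = (g i == Some u)) -> f = g.
Proof.
move=> fg; apply/ffunP => i; case fi: (f i) => [u|].
  by apply/esym/eqP; rewrite -fg fi.
by case gi: (g i) => [u|] //; have := fg i u; rewrite fi gi eqxx.
Qed.

(** * Elements as relations *)

Section LeftAction.
Variables (gT : finGroupType) (S : finType) (to : {action gT &-> S}).

Lemma lact1 s : lact to 1 s = s.
Proof. by rewrite /lact invg1 act1. Qed.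

Lemma lactM g h s : lact to (g * h) s = lact to g (lact to h s).
Proof. by rewrite /lact invMg actM. Qed.

Lemma lactK g s : lact to g^-1 (lact to g s) = s.
Proof. by rewrite -lactM mulVg lact1. Qed.

Lemma lactKV g s : lact to g (lact to g^-1 s) = s.
Proof. by rewrite -lactM mulgV lact1. Qed.

End LeftAction.

(** * Congruences: the abstract form of the relations of elements *)

Section Congruence.
Variables (gT : finGroupType) (S : finType) (to : {action gT &-> S}).
Variables (T : finType) (tau : {set T}).

(** The axioms that characterize the sets [relation x]. Arcs form a groupoid with gains in [gT], and
    hues are a partial coloring compatible with it. By [cg_join] all colored points form a single
    zero block, with every gain that its colors allow; by [cg_free] a point outside it has no
    nontrivial loop. *)
Record congruence (A : {set datum gT S T}) : Prop := Congruence {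
  cg_arc : forall i g j, arc i g j \in A -> i \in tau;
  cg_hue : forall i s, hue i s \in A -> i \in tau;
  cg_refl : forall i, i \in tau -> arc i 1 i \in A;
  cg_sym : forall i g j, arc i g j \in A -> arc j g^-1 i \in A;
  cg_trans : forall i g j h k,
    arc i g j \in A -> arc j h k \in A -> arc i (g * h) k \in A;
  cg_act : forall i g j s,
    arc i g j \in A -> hue j s \in A -> hue i (lact to g s) \in A;
  cg_join : forall i g j s,
    hue i (lact to g s) \in A -> hue j s \in A -> arc i g j \in A;
  cg_fun : forall i s t, hue i s \in A -> hue i t \in A -> s = t;
  cg_free : forall i g,
    arc i g i \in A -> g = 1 \/ exists s, hue i s \in A }.

Section CongruenceTheory.
Variables (A : {set datum gT S T}) (cA : congruence A).

Lemma cg_arcr i g j : arc i g j \in A -> j \in tau.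
Proof. by move/(cg_sym cA)/(cg_arc cA). Qed.

Lemma cg_act_sym i g j s :
  arc i g j \in A -> hue i s \in A -> hue j (lact to g^-1 s) \in A.
Proof. by move/(cg_sym cA)/(cg_act cA); apply. Qed.

Lemma cg_div i g j h k :
  arc i g k \in A -> arc j h k \in A -> arc i (g * h^-1) j \in A.
Proof. by move=> ik /(cg_sym cA); apply: cg_trans. Qed.

(** Two gains between the same points differ by a loop at [i], which is trivial because [i] is
    uncolored. *)
Lemma cg_gain_uniq i g h j :
    arc i g j \in A -> arc i h j \in A -> (forall s, hue i s \notin A) ->
  g = h.
Proof.
move=> ij ij' Ni; have [/eqP|[s si]] := cg_free cA (cg_div ij ij').
  by rewrite -eq_mulgV1 => /eqP.
by have := Ni s; rewrite si.
Qed.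

End CongruenceTheory.

(** The common upper bound [C] serves freeness: a nontrivial loop in both sets yields a color in [A]
    and one in [B], and these agree because both lie in [C]. *)
Lemma congruenceI A B C :
    congruence A -> congruence B -> congruence C ->
    A \subset C -> B \subset C -> congruence (A :&: B).
Proof.
move=> cA cB cC /subsetP AC /subsetP BC; split.
- by move=> i g j /setIP[/(cg_arc cA)].
- by move=> i s /setIP[/(cg_hue cA)].
- by move=> i it; rewrite inE !cg_refl.
- by move=> i g j /setIP[? ?]; rewrite inE !cg_sym.
- move=> i g j h k /setIP[? ?] /setIP[? ?].
  by rewrite inE (cg_trans cA (j := j)) ?(cg_trans cB (j := j)).
- move=> i g j s /setIP[? ?] /setIP[? ?].
  by rewrite inE (cg_act cA (j := j)) ?(cg_act cB (j := j)).
- move=> i g j s /setIP[? ?] /setIP[? ?].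
  by rewrite inE (cg_join cA (s := s)) ?(cg_join cB (s := s)).
- by move=> i s t /setIP[? _] /setIP[? _]; apply: (cg_fun cA (i := i)).
- move=> i g /setIP[iA iB].
  have [|[s sA]] := cg_free cA iA; first by left.
  have [|[t tB]] := cg_free cB iB; first by left.
  right; exists s; rewrite inE sA (_ : s = t) //.
  exact: (cg_fun cC (AC _ sA) (BC _ tB)).
Qed.

(** A right shift of [b] preserves the condition on the gain, so any representative of the class may
    be used. The conjunct [isSome (b j)] excludes points outside the block, where both sides would
    be [None]. *)
Definition relation (x : dowling to tau) : {set datum gT S T} :=
  [set d | match d with
    | inl (i, g, j) =>
        [exists b, [&& pclass b \in blocks x, isSome (b j) &
                       b i == omap (mulg g) (b j)]]
        || [exists s, (zero_coloring x j == Some s)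
                      && (zero_coloring x i == Some (lact to g s))]
    | inr (i, s) => zero_coloring x i == Some s
    end].

Lemma in_relation_arc x i g j :
  reflect ((exists b h, [/\ pclass b \in blocks x, b i = Some (g * h)
                          & b j = Some h])
           \/ (exists s, hue i (lact to g s) \in relation x
                         /\ hue j s \in relation x))
          (arc i g j \in relation x).
Proof.
rewrite inE; apply: (iffP orP).
  case=> [/existsP[b /and3P[bx]]|/existsP[s /andP[js is_]]].
    by case bj: (b j) => [h|] //= _ /eqP bi; left; exists b, h.
  by right; exists s; rewrite !inE.
case=> [[b [h [bx bi bj]]]|[s []]]; last first.
  by rewrite !inE => ? ?; right; apply/existsP; exists s; apply/andP.
by left; apply/existsP; exists b; rewrite bx bj bi /= eqxx.
Qed.

Lemma in_relation_hue x i s :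
  (hue i s \in relation x) = (zero_coloring x i == Some s).
Proof. by rewrite inE. Qed.

Lemma dowling_atlas (x : dowling to tau) :
  atlas tau (blocks x) (zero_coloring x).
Proof.
by apply/dowling_axiomP; rewrite -surjective_pairing; apply: (valP x).
Qed.

Lemma zero_coloring_None (x : dowling to tau) i :
  (forall s, hue i s \notin relation x) <-> zero_coloring x i = None.
Proof.
split=> [Ni|iN s]; last by rewrite in_relation_hue iN.
by case E: (zero_coloring x i) => [s|] //; have := Ni s; rewrite in_relation_hue E eqxx.
Qed.

(** Both classes contain [i] in their block, so [b] is a shift of [c]; agreement at [i] forces the
    shift to be by 1. *)
Lemma atlas_shift beta (z : {ffun T -> option S}) (b c : coloring T gT) i h :
    atlas tau beta z -> pclass b \in beta -> pclass c \in beta ->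
    b i = Some h -> c i = Some h -> b = c.
Proof.
move=> at_ bx cx bi ci.
have : b \in pclass c.
  by rewrite -(atlas_eq at_ bx cx (i := i)) ?bi ?ci ?pclass_refl.
case/pclassP => g bE; move: bi; rewrite bE ffunE ci /= => -[].
by move=> /(canRL (mulKg h)); rewrite mulVg => ->; rewrite rshift1.
Qed.

Lemma dowling_chart (x : dowling to tau) i :
    i \in tau -> zero_coloring x i = None ->
  exists2 b, pclass b \in blocks x & b i = Some 1.
Proof.
move=> it iN; have [b bx] := atlas_cover (dowling_atlas x) it iN.
case bi: (b i) => [h|] // _; exists (rshift b h^-1); first by rewrite pclass_rshift.
by rewrite ffunE bi /= mulgV.
Qed.

(** A coloring is recovered from one of its values and the arcs into that point; this is why the
    relation determines the element. *)
Lemma block_coloringE (x : dowling to tau) b i h :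
    pclass b \in blocks x -> b i = Some h ->
  forall j k, (b j == Some k) = (arc j (k * h^-1) i \in relation x).
Proof.
move=> bx bi j k; apply/eqP/idP => [bj|].
  by apply/in_relation_arc; left; exists b, h; rewrite mulgKV.
have at_ := dowling_atlas x.
case/in_relation_arc => [[c [l [cx cj ci]]]|[s []]]; last first.
  by rewrite !in_relation_hue (atlas_nonzero at_ bx (i := i)) ?bi.
have bc: b = rshift c (l^-1 * h).
  apply: (atlas_shift at_ (i := i) (h := h)) => //.
    by rewrite pclass_rshift.
  by rewrite ffunE ci /= mulKVg.
by rewrite bc ffunE cj /= !mulgA mulgK mulgKV.
Qed.

Lemma relation_congruence x : congruence (relation x).
Proof.
have at_ := dowling_atlas x.
have hue_tau i s : hue i s \in relation x -> i \in tau.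
  by rewrite in_relation_hue => /eqP zi; apply: (atlas_zero at_); rewrite zi.
have hue_fun i s t : hue i s \in relation x -> hue i t \in relation x -> s = t.
  by rewrite !in_relation_hue => /eqP-> /eqP[].
have sym i g j : arc i g j \in relation x -> arc j g^-1 i \in relation x.
  case/in_relation_arc => [[b [h [bx bi bj]]]|[s [si sj]]]; apply/in_relation_arc.
    by left; exists b, (g * h); rewrite mulKg.
  by right; exists (lact to g s); rewrite lactK.
have act i g j s :
    arc i g j \in relation x -> hue j s \in relation x ->
    hue i (lact to g s) \in relation x.
  case/in_relation_arc => [[b [h [bx bi bj]]]|[t [ti tj]]].
    by rewrite in_relation_hue (atlas_nonzero at_ bx) ?bj.
  by move=> sj; rewrite (hue_fun j s t).
split=> //.
- move=> i g j /in_relation_arc[[b [h [bx bi _]]]|[s [/hue_tau//]]].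
  by apply: (atlas_base at_ bx); rewrite bi.
- move=> i it; apply/in_relation_arc.
  case zi: (zero_coloring x i) => [s|].
    by right; exists s; rewrite lact1 !in_relation_hue zi.
  by have [b bx bi] := dowling_chart it zi; left; exists b, 1; rewrite mul1g.
- move=> i g j h k.
  case/in_relation_arc => [[b [l [bx bi bj]]] jk|[s [si sj]] jk].
    apply/in_relation_arc; case/in_relation_arc: (jk) => [[c [m [cx cj ck]]]|].
      (* The value of [b] at [k] is read off the reversed arc from [k] to [j]. *)
      left; exists b, (h^-1 * l); rewrite mulgA mulgK; split => //.
      by apply/eqP; rewrite (block_coloringE bx bj) mulgK sym.
    by case=> s [+ _]; rewrite in_relation_hue (atlas_nonzero at_ bx) ?bj.
  have sk := act _ _ _ _ (sym _ _ _ jk) sj.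
  apply/in_relation_arc; right; exists (lact to h^-1 s).
  by rewrite lactM lactKV.
- by move=> i g j s ? ?; apply/in_relation_arc; right; exists s.
- move=> i g /in_relation_arc[[b [h [bx -> [/eqP]]]]|[s [_ ?]]].
    by rewrite -{2}[h]mul1g => /eqP/mulIg; left.
  by right; exists s.
Qed.

Lemma relation_inj : injective relation.
Proof.
suff sub x y : relation x = relation y -> blocks x \subset blocks y.
  move=> x y xy; apply: val_inj.
  rewrite (surjective_pairing (val x)) (surjective_pairing (val y)).
  congr (_, _); first by apply/eqP; rewrite eqEsubset; apply/andP; split; apply: sub.
  by apply: ffun_option_ext => i s; rewrite -!in_relation_hue xy.
move=> xy; apply/subsetP => bt btx.
have [b btE] := atlas_class (dowling_atlas x) btx; subst bt.
have [i] := atlas_point (dowling_atlas x) btx.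
case bi: (b i) => [h|] // _.
have it : i \in tau by apply: (atlas_base (dowling_atlas x) btx); rewrite bi.
(* The point [i] is uncolored in [y] too, so [y] has a chart there. Shifted to agree with [b] at
   [i], it has the same arcs into [i] and hence equals [b]. *)
have iN : zero_coloring y i = None.
  apply/zero_coloring_None => s; rewrite -xy in_relation_hue.
  by rewrite (atlas_nonzero (dowling_atlas x) btx) ?bi.
have [c cy ci] := dowling_chart it iN.
have ci' : rshift c h i = Some h by rewrite ffunE ci /= mul1g.
have cy' : pclass (rshift c h) \in blocks y by rewrite pclass_rshift.
suff -> : b = rshift c h by [].
apply: ffun_option_ext => j k.
by rewrite (block_coloringE btx bi) (block_coloringE cy' ci') xy.
Qed.

(** * Decoding a congruence into an element *)

Section Decoding.
Variables (A : {set datum gT S T}) (cA : congruence A).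

Definition decode_zero : {ffun T -> option S} :=
  [ffun i => [pick s | hue i s \in A]].

(** The coloring of the block of [j] normalized to 1 at [j]. It is meaningful only for uncolored
    [j], where the gain picked is unique. *)
Definition chart j : coloring T gT := [ffun i => [pick g | arc i g j \in A]].

Definition decode_blocks : {set {set coloring T gT}} :=
  [set pclass (chart j) | j in [pred j | (j \in tau) && ~~ decode_zero j]].

Lemma decode_zeroE i s : (decode_zero i == Some s) = (hue i s \in A).
Proof.
rewrite ffunE; case: pickP => [t tA|->] //.
by apply/eqP/idP => [[<-]//|sA]; rewrite (cg_fun cA tA sA).
Qed.

Lemma decode_zeroN i : (forall s, hue i s \notin A) <-> decode_zero i = None.
Proof.
split=> [N|iN s]; last by rewrite -decode_zeroE iN.
by case E: (decode_zero i) => [s|] //; have := N s; rewrite -decode_zeroE E eqxx.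
Qed.

Lemma chartE j i g : decode_zero j = None ->
  (chart j i == Some g) = (arc i g j \in A).
Proof.
move=> /decode_zeroN jN; rewrite ffunE; case: pickP => [h hA|->] //.
apply/eqP/idP => [[<-]//|gA]; congr Some; apply: (cg_gain_uniq cA hA gA) => s.
by apply/negP => /(cg_act_sym cA hA); apply/negP.
Qed.

Lemma decode_blocksP bt :
  reflect (exists j, [/\ j \in tau, decode_zero j = None & bt = pclass (chart j)])
          (bt \in decode_blocks).
Proof.
apply: (iffP imsetP) => [[j]|[j [jt jN ->]]].
  by rewrite inE => /andP[jt]; case jN: (decode_zero j) => // _ ->; exists j.
by exists j; rewrite // inE jt jN.
Qed.

Lemma decode_atlas : atlas tau decode_blocks decode_zero.
Proof.
have chart_refl j : j \in tau -> decode_zero j = None -> chart j j = Some 1.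
  by move=> jt jN; apply/eqP; rewrite chartE // cg_refl.
have blockP b i : pclass b \in decode_blocks -> b i -> 
    exists j g, [/\ arc i g j \in A, decode_zero j = None
                   & pclass b = pclass (chart j)].
  case/decode_blocksP => j [jt jN bE]; have := pclass_refl b; rewrite bE.
  case/pclassP => g ->; rewrite isSome_rshift.
  case ci: (chart j i) => [h|] // _; exists j, h; split=> //.
  by rewrite -chartE // ci.
have nz i g j : arc i g j \in A -> decode_zero j = None -> decode_zero i = None.
  move=> ij /decode_zeroN jN; apply/decode_zeroN => s; apply/negP.
  by move/(cg_act_sym cA ij); apply/negP.
split.
- by move=> bt /decode_blocksP[j [_ _ ->]]; exists (chart j).
- move=> b /decode_blocksP[j [jt jN bE]]; exists j.
  have := pclass_refl b; rewrite bE => /pclassP[g ->].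
  by rewrite isSome_rshift chart_refl.
- move=> b c i bA cA' /(blockP _ _ bA)[j [g [ij jN ->]]].
  case/(blockP _ _ cA') => k [h [ik kN ->]].
  (* The common point [i] has gain [g] to [j] and [h] to [k], so [j] has gain [g^-1 * h] to [k], and
     the two charts differ by the inverse shift. *)
  suff -> : chart j = rshift (chart k) (h^-1 * g) by rewrite pclass_rshift.
  have jk : arc j (g^-1 * h) k \in A by apply: (cg_trans cA _ ik); apply: cg_sym.
  apply: ffun_option_ext => l m; rewrite chartE // [rshift _ _ l]ffunE.
  case E: (chart k l) => [m'|] /=; last first.
    apply/negP => lj; have := cg_trans cA lj jk.
    by rewrite -chartE // E.
  move/eqP: E; rewrite chartE // => lk; apply/idP/eqP => [lj|[<-]].
    suff -> : m' = m * (g^-1 * h) by rewrite !mulgA mulgK mulgKV.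
    apply: (cg_gain_uniq cA lk (cg_trans cA lj jk)) => s.
    apply/negP => /(cg_act_sym cA lk).
    by move/decode_zeroN: kN => /(_ (lact to m'^-1 s))/negP.
  by have := cg_div cA lk jk; rewrite invMg invgK.
- by move=> b i bA /(blockP _ _ bA)[j [g [/(cg_arc cA)]]].
- by move=> b i bA /(blockP _ _ bA)[j [g [/nz iN /iN]]].
- move=> i it iN; exists (chart i); last by rewrite chart_refl.
  by apply/decode_blocksP; exists i.
- move=> i; case E: (decode_zero i) => [s|] // _; move/eqP: E.
  by rewrite decode_zeroE => /(cg_hue cA).
Qed.

Definition decode : dowling to tau :=
  Dowling to (iffRL (dowling_axiomP tau decode_blocks decode_zero) decode_atlas).

(** With [relation_inj] and [relation_congruence], this makes [relation] a bijection from elements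
    onto congruences, so elements can be constructed by exhibiting congruences. *)
Lemma relation_decode : relation decode = A.
Proof.
have hueE i s : (hue i s \in relation decode) = (hue i s \in A).
  by rewrite in_relation_hue -decode_zeroE.
apply/setP => -[[[i g] j]|[i s]] //.
apply/in_relation_arc/idP => [[[b [h [bA bi bj]]]|[s []]]|ij]; last first.
- case E: (decode_zero j) => [s|].
    move/eqP: E; rewrite decode_zeroE => js; right; exists s; rewrite !hueE; split=> //.
    exact: (cg_act cA ij js).
  have jt := cg_arcr cA ij.
  left; exists (chart j), 1; rewrite mulg1; split.
  - by apply/decode_blocksP; exists j.
  - by apply/eqP; rewrite chartE.
  - by apply/eqP; rewrite chartE // cg_refl.
- by rewrite !hueE; apply: cg_join.
case/decode_blocksP: bA => k [kt kN bE].
have := pclass_refl b; rewrite bE => /pclassP[m bE'].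
move: bi bj; rewrite bE' ![rshift _ _ _]ffunE.
case ci: (chart k i) => [n|] //= [En]; case cj: (chart k j) => [n'|] //= [En'].
have -> : g = n * n'^-1.
  by apply: (mulIg n'); rewrite mulgKV; apply: (mulIg m); rewrite -mulgA En' En.
by apply: (cg_div cA (k := k)); rewrite -chartE // ?ci ?cj.
Qed.

End Decoding.

End Congruence.

(** * Covers and the order *)

Section Covers.
Variables (gT : finGroupType) (S : finType) (to : {action gT &-> S}).
Variables (T : finType) (tau : {set T}).
Implicit Types (x y : dowling to tau) (a b c d : coloring T gT).
Implicit Types (A : {set datum gT S T}).

Lemma pclass_isSome b c :
  pclass b = pclass c -> forall i, isSome (b i) = isSome (c i).
Proof.
by move=> /(congr1 (@underlying _ _)) + i; rewrite !underlying_pclass -!in_pdom => ->.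
Qed.

Lemma punionE (X : eqType) (f g : {ffun T -> option X}) i :
  punion f g i = if f i is Some u then Some u else g i.
Proof. by rewrite ffunE. Qed.

(** Arcs inside the zero block need no check, since [cg_join] derives them from the hues. *)
Lemma sub_relation x A :
    congruence to tau A ->
    (forall i s, zero_coloring x i = Some s -> hue i s \in A) ->
    (forall b i g j h, pclass b \in blocks x -> b i = Some (g * h) ->
       b j = Some h -> arc i g j \in A) ->
  relation x \subset A.
Proof.
move=> cA hueA arcA; apply/subsetP => -[[[i g] j]|[i s]]; last first.
  by rewrite in_relation_hue => /eqP; apply: hueA.
case/in_relation_arc => [[b [h [bx bi bj]]]|[s []]].
  exact: (arcA b i g j h).
by rewrite !in_relation_hue => /eqP/hueA si /eqP/hueA; apply: (cg_join cA) si.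
Qed.

Lemma color_step x A i s :
    congruence to tau A -> relation x \subset A ->
    zero_coloring x i = None -> hue i s \in A ->
  exists x', [/\ dowling_cover x x', relation x' \subset A
                & hue i s \in relation x'].
Proof.
move=> cA /subsetP xA iN si; have it := cg_hue cA si.
have at_ := dowling_atlas x; have [b bx bi] := dowling_chart it iN.
(* As [b] takes the value 1 at [i], an equivariant map giving [i] the color [s] must send 1 to [s],
   hence must be this one. *)
pose f : {ffun gT -> S} := [ffun g => lact to g s].
pose beta := blocks x :\ pclass b.
pose z := punion (zero_coloring x) [ffun j => omap f (b j)].
have zE j : z j = if zero_coloring x j is Some t then Some t
                  else if b j is Some g then Some (lact to g s) else None.
  rewrite punionE; case: (zero_coloring x j) => //; rewrite ffunE.
  by case: (b j) => //= g; rewrite ffunE.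
have bN j c : pclass c \in beta -> c j -> b j = None.
  rewrite !inE => /andP[/eqP cb cx] cj; case bj: (b j) => [g|] //; case: cb.
  by apply: (atlas_eq at_ (i := j)); rewrite ?bj.
have at' : atlas tau beta z.
  split.
  - by move=> bt /setD1P[_ /(atlas_class at_)].
  - by move=> c /setD1P[_ /(atlas_point at_)].
  - by move=> c d j /setD1P[_ cx] /setD1P[_ dx]; apply: (atlas_eq at_).
  - by move=> c j /setD1P[_ cx]; apply: (atlas_base at_).
  - move=> c j cb cj; rewrite zE (bN j c) //.
    by case/setD1P: cb => _ cx; rewrite (atlas_nonzero at_ cx).
  - move=> j jt; rewrite zE; case zj: (zero_coloring x j) => //.
    case bj: (b j) => // _; have [c cx cj] := atlas_cover at_ jt zj.
    exists c; rewrite // !inE cx andbT; apply/eqP => /pclass_isSome/(_ j).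
    by rewrite cj bj.
  - move=> j; rewrite zE; case zj: (zero_coloring x j) => [t|].
      by move=> _; apply: (atlas_zero at_); rewrite zj.
    by case bj: (b j) => [g|] // _; apply: (atlas_base at_ bx); rewrite bj.
pose x' : dowling to tau := Dowling to (iffRL (dowling_axiomP tau beta z) at').
have hueA j t : zero_coloring x' j = Some t -> hue j t \in A.
  rewrite [zero_coloring _ _]zE; case zj: (zero_coloring x j) => [u|].
    by case=> <-; apply: xA; rewrite in_relation_hue zj.
  case bj: (b j) => [g|] // -[<-]; apply: (cg_act cA) si; apply: xA.
  by rewrite -[g]mulg1 -invg1 -(block_coloringE bx bi) bj.
exists x'; split.
- apply/orP; right; apply/existsP; exists b; apply/existsP; exists f.
  apply/and4P; split=> //.
  by apply/forallP => g; apply/forallP => h; rewrite !ffunE lactM.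
- apply: sub_relation => // c j g k h /setD1P[_ cx] cj ck; apply: xA.
  by apply/in_relation_arc; left; exists c, h.
- by rewrite in_relation_hue [zero_coloring _ _]zE iN bi lact1.
Qed.

Lemma merge_step x A i g j :
    congruence to tau A -> relation x \subset A ->
    zero_coloring x i = None -> zero_coloring x j = None ->
    (forall h, arc i h j \notin relation x) -> arc i g j \in A ->
  exists x', [/\ dowling_cover x x', relation x' \subset A
                & arc i g j \in relation x'].
Proof.
move=> cA /subsetP xA iN jN Nij ij.
have at_ := dowling_atlas x; have cx := relation_congruence x.
have [a ax ai] := dowling_chart (cg_arc cA ij) iN.
have [b bx bj] := dowling_chart (cg_arcr cA ij) jN.
have aE k u : (a k == Some u) = (arc k u i \in relation x).
  by rewrite (block_coloringE ax ai) invg1 mulg1.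
have bE k u : (b k == Some u) = (arc k u j \in relation x).
  by rewrite (block_coloringE bx bj) invg1 mulg1.
(* A point common to both blocks would link [i] and [j] by an arc of [x], against the hypothesis. *)
have ab k : a k -> b k = None.
  case ak: (a k) => [u|] // _; case bk: (b k) => [v|] //.
  move/eqP: ak; move/eqP: bk; rewrite aE bE => /(cg_sym cx) jk /(cg_sym cx) ik.
  by have := cg_div cx ik jk; rewrite (negPf (Nij _)).
have Nab : pclass a != pclass b.
  apply/eqP => /pclass_isSome/(_ i); rewrite ai => /esym.
  by rewrite ab ?ai.
(* Since [a] is 1 at [i] and [b] is 1 at [j], the merged coloring takes the values 1 and [g^-1]
   there, whose quotient is the required gain [g]. *)
pose c := punion a (rshift b g^-1).
have cE k : c k = if a k is Some u then Some u else omap (mulg^~ g^-1) (b k).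
  by rewrite punionE; case: (a k) => //; rewrite ffunE.
pose beta := pclass c |: (blocks x :\: [set pclass a; pclass b]).
have betaP bt : bt \in beta ->
    bt = pclass c \/ [/\ bt \in blocks x, bt <> pclass a & bt <> pclass b].
  case/setU1P => [|/setDP[bt_x]]; first by left.
  by rewrite !inE => /norP[/eqP? /eqP?]; right.
have c_ab d k : c k -> pclass d \in blocks x -> d k ->
    pclass d = pclass a \/ pclass d = pclass b.
  rewrite cE => ck dx dk; case ak: (a k) ck => [u|].
    by move=> _; left; apply: (atlas_eq at_ (i := k)); rewrite ?ak.
  case bk: (b k) => [v|] // _.
  by right; apply: (atlas_eq at_ (i := k)); rewrite ?bk.
have c_base k : c k -> k \in tau /\ zero_coloring x k = None.
  rewrite cE; case ak: (a k) => [u|].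
    by split; [apply: (atlas_base at_ ax)|apply: (atlas_nonzero at_ ax)]; rewrite ak.
  case bk: (b k) => [v|] // _.
  by split; [apply: (atlas_base at_ bx)|apply: (atlas_nonzero at_ bx)]; rewrite bk.
have at' : atlas tau beta (zero_coloring x).
  split.
  - move=> bt /betaP[->|[bt_x _ _]]; first by exists c.
    exact: (atlas_class at_ bt_x).
  - move=> d /betaP[dc|[dx _ _]]; last exact: (atlas_point at_ dx).
    by exists i; rewrite (pclass_isSome dc) cE ai.
  - move=> d e k /betaP[dc|[dx da db]] /betaP[ec|[ex ea eb]] dk ek.
    + by rewrite dc ec.
    + by rewrite (pclass_isSome dc) in dk; case: (c_ab e k).
    + by rewrite (pclass_isSome ec) in ek; case: (c_ab d k).
    + exact: (atlas_eq at_ (i := k)).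
  - move=> d k /betaP[dc|[dx _ _]]; last exact: (atlas_base at_).
    by rewrite (pclass_isSome dc) => /c_base[].
  - move=> d k /betaP[dc|[dx _ _]]; last exact: (atlas_nonzero at_).
    by rewrite (pclass_isSome dc) => /c_base[].
  - move=> k kt kN; have [d dx dk] := atlas_cover at_ kt kN.
    have [da|/eqP da] := eqVneq (pclass d) (pclass a).
      exists c; first by rewrite setU11.
      by move: dk; rewrite (pclass_isSome da) cE; case: (a k).
    have [db|/eqP db] := eqVneq (pclass d) (pclass b).
      exists c; first by rewrite setU11.
      by move: dk; rewrite (pclass_isSome db) cE; case: (a k); case: (b k).
    exists d => //; rewrite !inE dx andbT.
    by apply/orP; right; apply/norP; split; apply/eqP.
  - exact: (atlas_zero at_).
pose x' : dowling to tau := Dowling to (iffRL (dowling_axiomP tau beta _) at').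
(* The value of [c] at a point is a gain to [i] allowed by [A]; dividing two such arcs gives every
   arc of the merged block. *)
have cA_i k u : c k = Some u -> arc k u i \in A.
  rewrite cE; case ak: (a k) => [v|].
    by case=> <-; apply: xA; rewrite -aE ak.
  case bk: (b k) => [v|] //= [<-]; apply: (cg_div cA) ij.
  by apply: xA; rewrite -bE bk.
exists x'; split.
- apply/orP; left; apply/existsP; exists a; apply/existsP; exists b.
  by apply/existsP; exists g^-1; apply/and5P; split.
- apply: sub_relation => // [k s ks|d k f l h /betaP[dc|[dx _ _]] dk dl].
  + by apply: xA; rewrite in_relation_hue; apply/eqP.
  + have := pclass_refl d; rewrite dc => /pclassP[t dE].
    move: dk dl; rewrite dE ![rshift _ _ _]ffunE.
    case ck: (c k) => [u|] //= [uE]; case cl: (c l) => [v|] //= [vE].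
    have -> : f = u * v^-1.
      by apply: (mulIg v); rewrite mulgKV; apply: (mulIg t); rewrite -mulgA vE uE.
    by apply: (cg_div cA); apply: cA_i.
  + by apply: xA; apply/in_relation_arc; left; exists d, h.
- apply/in_relation_arc; left; exists c, g^-1; split; first exact: setU11.
    by rewrite cE ai mulgV.
  rewrite cE; case aj: (a j) => [u|]; last by rewrite bj /= mul1g.
  by have := ab j; rewrite aj bj => /(_ isT).
Qed.

Lemma cover_sub x y : dowling_cover x y -> relation x \subset relation y.
Proof.
have cy := relation_congruence y; have at_ := dowling_atlas x.
case/orP=> [|/existsP[b /existsP[f /and4P[/forallP eqf bx /eqP yE /eqP zE]]]].
  case/existsP=> a /existsP[b /existsP[g /and5P[ax bx ab /eqP yE /eqP zE]]].
  apply: sub_relation => // [i s|c i h j k cx ci cj].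
    by rewrite -zE in_relation_hue => /eqP.
  have [ca|Nca] := eqVneq (pclass c) (pclass a).
    have := pclass_refl c; rewrite ca => /pclassP[l cE].
    apply/in_relation_arc; left; exists (rshift (punion a (rshift b g)) l), k.
    rewrite pclass_rshift yE setU11 -ci -cj cE ![rshift _ l _]ffunE !punionE.
    have ai : a i by rewrite -(pclass_isSome ca) ci.
    have aj : a j by rewrite -(pclass_isSome ca) cj.
    by case: (a i) ai => // ? _; case: (a j) aj.
  have [cb|Ncb] := eqVneq (pclass c) (pclass b).
    have := pclass_refl c; rewrite cb => /pclassP[l cE].
    have aN m : b m -> a m = None.
      move=> bm; case am: (a m) => [u|] //; case/eqP: ab.
      by apply: (atlas_eq at_ (i := m)); rewrite ?am.
    have bi : b i by rewrite -(pclass_isSome cb) ci.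
    have bj : b j by rewrite -(pclass_isSome cb) cj.
    apply/in_relation_arc; left.
    (* On the block of [b] the merged coloring is [rshift b g]; this shift undoes [g] and then
       applies [l], recovering [c]. *)
    exists (rshift (punion a (rshift b g)) (g^-1 * l)), k.
    have E m : b m -> rshift (punion a (rshift b g)) (g^-1 * l) m = rshift b l m.
      move=> bm; rewrite ffunE punionE aN // !ffunE.
      by case: (b m) => //= u; rewrite mulgA mulgK.
    by rewrite pclass_rshift yE setU11 -ci -cj cE !E.
  apply/in_relation_arc; left; exists c, k; split=> //.
  by rewrite yE !inE cx (negPf Nca) (negPf Ncb) orbT.
have zyE i : zero_coloring y i =
    if zero_coloring x i is Some s then Some s else omap f (b i).
  by rewrite zE punionE; case: (zero_coloring x i) => //; rewrite ffunE.
apply: sub_relation => // [i s zi|c i h j k cx ci cj].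
  by rewrite in_relation_hue zyE zi.
have [cb|Ncb] := eqVneq (pclass c) (pclass b); last first.
  apply/in_relation_arc; left; exists c, k; split=> //.
  by rewrite yE !inE cx Ncb.
have := pclass_refl b; rewrite -cb => /pclassP[l bE].
have nz m : c m -> zero_coloring x m = None by apply: (atlas_nonzero at_).
(* Since [b] is [c] shifted by [l], its value at [j] is [k * l], so this is the new color of [j];
   equivariance turns the gain [h] into the action of [h] on it. *)
apply/in_relation_arc; right; exists (f (k * l)).
rewrite !in_relation_hue !zyE !nz ?ci ?cj // bE !ffunE ci cj /= eqxx.
by rewrite -mulgA; have /forallP/(_ (k * l))/eqP -> := eqf h.
Qed.

(** Any datum of a congruence above [x] is acquired by at most one cover inside that congruence. For
    an arc with one colored end, color the block of the other end; if both ends are uncolored and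
    unrelated, merge their blocks; if they are related by another gain, color their common block.
    This drives both the description of the order and the geometricity of intervals. *)
Lemma relation_step x A (e : datum gT S T) :
    congruence to tau A -> relation x \subset A -> e \in A ->
  e \in relation x \/
  exists x', [/\ dowling_cover x x', relation x' \subset A & e \in relation x'].
Proof.
move=> cA xA; case: e => [[[i g] j]|[i s]] dA; last first.
  case zi: (zero_coloring x i) => [t|]; last by right; apply: color_step.
  have : hue i t \in relation x by rewrite in_relation_hue zi.
  by move=> /[dup] ? /(subsetP xA) /(cg_fun cA dA) ->; left.
have cx := relation_congruence x.
have hue_step k s : hue k s \in A ->
    exists x', [/\ x' = x \/ dowling_cover x x', relation x' \subset A,
                   relation x \subset relation x' & hue k s \in relation x'].
  move=> sA; case zk: (zero_coloring x k) => [t|].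
    have tx: hue k t \in relation x by rewrite in_relation_hue zk.
    by exists x; split=> //; [left|rewrite (cg_fun cA sA (subsetP xA _ tx))].
  have [x' [xx' x'A sx']] := color_step cA xA zk sA.
  by exists x'; split=> //; [right|apply: cover_sub].
suff [x' [[->|xx'] x'A ijx']] : exists x',
    [/\ x' = x \/ dowling_cover x x', relation x' \subset A
       & arc i g j \in relation x'].
  by left.
  by right; exists x'.
have hueP k : zero_coloring x k = None \/ exists s, hue k s \in relation x.
  case zk: (zero_coloring x k) => [s|]; last by left.
  by right; exists s; rewrite in_relation_hue zk.
have [iN|[s si]] := hueP i; last first.
  have [x' [xx' x'A xsub hx']] := hue_step _ _ (cg_act_sym cA dA (subsetP xA _ si)).
  exists x'; split=> //; apply: (cg_join (relation_congruence x')) hx'.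
  by rewrite lactKV; apply: (subsetP xsub).
have [jN|[s sj]] := hueP j; last first.
  have [x' [xx' x'A xsub hx']] := hue_step _ _ (cg_act cA dA (subsetP xA _ sj)).
  exists x'; split=> //; apply: (cg_join (relation_congruence x') hx').
  exact: (subsetP xsub).
have [/existsP[h hx]|/existsPn Nx] :=
  boolP [exists h, arc i h j \in relation x]; last first.
  have [x' [xx' x'A ijx']] := merge_step cA xA iN jN Nx dA.
  by exists x'; split=> //; right.
have hA := subsetP xA _ hx.
(* In [x] the two points are related with gain [h]. If [g] differs from [h], the loop [g * h^-1] is
   nontrivial, so [A] colors [i], and the step takes that color. *)
have [/eqP|[s si]] := cg_free cA (cg_div cA dA hA).
  by rewrite -eq_mulgV1 => /eqP ->; exists x; split; [left| |].
have [x' [xx' x'A xsub hx']] := hue_step _ _ si.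
exists x'; split=> //.
apply: (cg_join (relation_congruence x')) (_ : hue j (lact to g^-1 s) \in _).
  by rewrite lactKV.
have hj' := cg_act_sym (relation_congruence x') (subsetP xsub _ hx) hx'.
by rewrite (cg_fun cA (cg_act_sym cA dA si) (subsetP x'A _ hj')).
Qed.

Lemma dowling_leE x y : (x <= y) = (relation x \subset relation y).
Proof.
apply/idP/idP => [/connectP[p]|].
  elim: p x => [|z p IHp] x /=; first by move=> _ ->.
  by move=> /andP[/cover_sub xz /IHp zy yE]; apply: subset_trans (zy yE).
(* As long as the inclusion is strict, a missing datum yields a cover of [x] still contained in [y],
   with fewer blocks. *)
have [n] := ubnP #|blocks x|; elim: n x => // n IHn x len xy.
have [yx|/subsetPn[d dy dNx]] := boolP (relation y \subset relation x).
  by rewrite (relation_inj (x1 := x) (x2 := y)) //; apply/eqP; rewrite eqEsubset xy.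
have [dx|[x' [xx' x'y _]]] := relation_step (relation_congruence y) xy dy.
  by rewrite dx in dNx.
apply: le_trans (connect1 xx') (IHn x' _ x'y).
exact: leq_trans (dowling_cover_card xx') len.
Qed.

(** A merge loses exactly one block because the merged class is new among those kept: it meets the
    block of [a], which has been removed. Counting blocks thus gives a rank function. *)
Lemma dowling_cover_cardE x y : dowling_cover x y -> #|blocks x| = #|blocks y|.+1.
Proof.
have at_ := dowling_atlas x.
case/orP=> [|/existsP[b /existsP[f /and4P[_ bx /eqP-> _]]]]; last first.
  by rewrite (cardsD1 (pclass b)) bx.
case/existsP=> a /existsP[b /existsP[g /and5P[ax bx ab /eqP-> _]]].
have [i ai] := atlas_point at_ ax.
have cN : pclass (punion a (rshift b g)) \notin blocks x :\: [set pclass a; pclass b].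
  apply/negP => /setDP[cx]; rewrite !inE => /norP[/eqP Na _]; apply: Na.
  by apply: (atlas_eq at_ (i := i)) => //; rewrite punionE; case: (a i) ai.
have sub : [set pclass a; pclass b] \subset blocks x.
  by apply/subsetP => c /set2P[]->.
by rewrite cardsU1 cN -(cardsID [set pclass a; pclass b]) (setIidPr sub) cards2 ab.
Qed.

End Covers.

(** * Geometric lattices *)

Section GeometricLattices.
Variables (d : Order.disp_t) (P : finPOrderType d).
Variables (bot top : P) (meet : P -> P -> P) (rk : P -> nat).

Definition atom (p : P) := (bot < p) && ~~ [exists z : P, (bot < z) && (z < p)].

Hypothesis le_bot : forall x, bot <= x.
Hypothesis le_top : forall x, x <= top.
Hypothesis le_meet : forall x y z, (x <= meet y z) = (x <= y) && (x <= z).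
Hypothesis rk_bot : rk bot = 0%N.
Hypothesis rk_lt : {homo rk : x y / x < y >-> (x < y)%N}.
Hypothesis atom_sep : forall x y, ~~ (y <= x) ->
  exists p, [/\ atom p, p <= y & ~~ (p <= x)].
Hypothesis rk_atom : forall x p, atom p ->
  exists u, [/\ x <= u, p <= u & (rk u <= (rk x).+1)%N].

(* Submodularity: climb from [x /\ y] to [x] by joining atoms; each of them
   raises the rank of the current element by at least one, and that of its join
   with [y] by at most one. *)
Lemma geometric_lattice_of_rank : geometric_lattice P.
Proof.
pose mM := Order.POrder_isMeetSemilattice.Build d P le_meet.
pose mT := Order.hasTop.Build d P le_top.
pose mB := Order.hasBottom.Build d P le_bot.
pose M : Order.TMeetSemilattice.type d := HB.pack P mM mT.
(* In a finite meet semilattice with top, the join is the meet of all common upper bounds. *)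
pose join x y : P := \meet_(z : P | (x <= z) && (y <= z)) (z : M).
have joinP x y z : (join x y <= z) = (x <= z) && (y <= z).
  apply/idP/idP => [xyz|]; last by move=> xyz; apply: (@meets_inf _ M).
  apply/andP; split; apply: le_trans xyz; apply/(@meetsP _ M) => w /andP[]//.
pose mJ := Order.POrder_isJoinSemilattice.Build d P joinP.
pose L : finTBLatticeType d := HB.pack P mM mT mB mJ.
exists d, L; split; first by exists id; split; first by exists id.
- have mono (x y : L) : x <= y -> (rk x <= rk y)%N.
    by rewrite le_eqVlt => /predU1P[->//|/rk_lt/ltnW].
  have rkU (x p : L) : atom p -> (rk (x `|` p) <= (rk x).+1)%N.
    move=> /(rk_atom x)[u [xu pu]]; apply: leq_trans; apply: mono.
    by rewrite leUx xu.
  (* The climb from [c] to [a], by induction on the remaining rank, with [b] joined throughout. *)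
  have step (b a c : L) : c <= a -> (rk (b `|` a) + rk c <= rk (b `|` c) + rk a)%N.
    have [n] := ubnP (rk a - rk c)%N; elim: n c => // n IHn c len ca.
    have [ac|Nac] := boolP (a <= c).
      by rewrite (le_anti (introT andP (conj ac ca))).
    have [p [atp pa Npc]] := atom_sep Nac.
    have lt : (rk c < rk (c `|` p))%N.
      apply: rk_lt; suff: (c : L) < c `|` p by [].
      by rewrite lt_neqAle leUl andbT eq_sym eq_joinl.
    have le : c `|` p <= a by rewrite leUx ca.
    have le1 := mono _ _ le.
    have {}IHn : (rk (b `|` a) + rk (c `|` p) <= rk (b `|` (c `|` p)) + rk a)%N.
      apply: IHn le; rewrite ltnS in len; apply: leq_trans len.
      by apply: ltn_sub2l => //; apply: leq_trans lt le1.
    have le2 : (rk (b `|` (c `|` p)) <= (rk (b `|` c)).+1)%N.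
      by rewrite joinA; apply: rkU.
    rewrite -ltnS -[(_ + rk a).+1]addSn -addnS; apply: leq_trans (leq_add le2 (leqnn _)).
    by apply: leq_trans IHn; rewrite leq_add2l.
  exists rk; split=> // [x y /andP[xy /existsPn Nxy]|x y].
    (* An atom below [y] but not below [x] has join [y] with [x], because [y] covers [x]; hence the
       rank rises by exactly one. *)
    have [p [atp py Npx]] := atom_sep (x := x) (y := y) (negbT (lt_geF xy)).
    have lt : x < (x `|` p : L).
      by rewrite lt_neqAle leUl andbT eq_sym eq_joinl.
    apply/eqP; rewrite eqn_leq rk_lt // andbT.
    have := Nxy (x `|` p : L); rewrite lt negb_and /= lt_neqAle negb_and negbK.
    by rewrite leUx py (ltW xy) orbF => /eqP <-; apply: rkU.
  (* By absorption [y] joined with the meet is [y], so this instance is the submodular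
     inequality. *)
  have := step y x (x `&` y) (leIl x y).
  by rewrite joinC (join_l (leIr y x)) addnC [(rk y + _)%N]addnC.
- move=> x; apply: le_anti; apply/andP; split; last first.
    by apply/joinsP => a /andP[].
  apply: contraT => /atom_sep[p [atp px /negP[]]].
  by apply: (@joins_sup _ L); rewrite px andbT.
Qed.

End GeometricLattices.

HB.instance Definition _ d (P : finPOrderType d) (x y : P) :=
  [Finite of segment x y by <:].

(** * Closed intervals are geometric *)

Section SegmentGeometric.
Variables (gT : finGroupType) (S : finType) (to : {action gT &-> S}).
Variables (T : finType) (tau : {set T}).

Lemma dowling_meet_subproof (y u v : dowling to tau) :
  u <= y -> v <= y -> congruence to tau (relation u :&: relation v).
Proof.
rewrite !dowling_leE.
exact: congruenceI (relation_congruence u) (relation_congruence v)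
  (relation_congruence y).
Qed.

Definition dowling_meet (y u v : dowling to tau) (uy : u <= y) (vy : v <= y) :=
  decode (dowling_meet_subproof uy vy).

Lemma le_dowling_meet (y u v w : dowling to tau) (uy : u <= y) (vy : v <= y) :
  (w <= dowling_meet uy vy) = (w <= u) && (w <= v).
Proof. by rewrite !dowling_leE relation_decode subsetI. Qed.

Lemma dowling_meet_le (y u v : dowling to tau) (uy : u <= y) (vy : v <= y) :
  (dowling_meet uy vy <= u) && (dowling_meet uy vy <= v).
Proof. by rewrite -(le_dowling_meet _ uy vy). Qed.

Lemma geometric_segment (x y : dowling to tau) :
  x <= y -> geometric_lattice (segment x y).
Proof.
move=> xy; pose sg := segment x y.
have leE (u v : sg) : (u <= v) = (val u <= val v) by rewrite leEsub.
have ge_x (u : sg) : x <= val u by case/andP: (valP u).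
have le_y (u : sg) : val u <= y by case/andP: (valP u).
have mk z : x <= z -> z <= y -> {u : sg | val u = z}.
  by move=> xz zy; exists (exist _ z (introT andP (conj xz zy))).
have [bot botE] := mk x (lexx x) xy; have [top topE] := mk y xy (lexx y).
have meetP (u v : sg) : x <= dowling_meet (le_y u) (le_y v) <= y.
  rewrite le_dowling_meet !ge_x /=; apply: le_trans (le_y u).
  by case/andP: (dowling_meet_le (le_y u) (le_y v)).
pose meet (u v : sg) : sg := exist _ (dowling_meet (le_y u) (le_y v)) (meetP u v).
have le_meet (w u v : sg) : (w <= meet u v) = (w <= u) && (w <= v).
  by rewrite !leE le_dowling_meet.
(* The rank counts the blocks lost since [x]; each cover loses exactly one. *)
pose rk (u : sg) := (#|blocks x| - #|blocks (val u)|)%N.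
have card_le (u v : dowling to tau) : u <= v -> (#|blocks v| <= #|blocks u|)%N.
  by case/dowling_le_card => [->|/ltnW].
have rk_lt : {homo rk : u v / u < v >-> (u < v)%N}.
  move=> u v uv; have := uv; rewrite ltEsub lt_neqAle => /andP[Nuv].
  case/dowling_le_card => [/eqP|lt]; first by rewrite (negPf Nuv).
  by apply: ltn_sub2l => //; apply: leq_trans lt (card_le _ _ (ge_x u)).
have step (w v : sg) (e : datum gT S T) : e \in relation (val v) -> w <= v ->
    e \notin relation (val w) ->
    exists u : sg, [/\ dowling_cover (val w) (val u), u <= v & e \in relation (val u)].
  rewrite leE dowling_leE => ev wv ew.
  have [|[u [wu uv eu]]] := relation_step (relation_congruence (val v)) wv ev.
    by rewrite (negPf ew).
  rewrite -dowling_leE in uv.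
  have [|//|u' u'E] := mk u; first by apply: le_trans (ge_x w) (connect1 wu).
    exact: le_trans uv (le_y v).
  by exists u'; rewrite leE u'E.
have sub (u v : sg) : u <= v -> relation (val u) \subset relation (val v).
  by rewrite leE dowling_leE.
have bot_le (u : sg) : bot <= u by rewrite leE botE.
apply: (@geometric_lattice_of_rank _ sg bot top meet rk) => //.
- by move=> u; rewrite leE topE.
- by rewrite /rk botE subnn.
(* A datum of [v] missing from [u] is missing from [x] as well. Acquiring it by one step from [x]
   below [v] gives an element of rank one, which leaves no room for anything strictly between. *)
- move=> u v; rewrite leE dowling_leE => /subsetPn[e ev Neu].
  have Neb : e \notin relation (val bot).
    by apply: contra Neu => /(subsetP (sub _ _ (bot_le u))).
  have [p [bp pv ep]] := step bot v e ev (bot_le v) Neb.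
  exists p; split=> //; last by rewrite leE dowling_leE; apply: contra Neu => /subsetP->.
  apply/andP; split.
    by rewrite lt_neqAle bot_le andbT; apply: contraNneq Neb => ->.
  apply/existsPn => z; apply/negP => /andP[/rk_lt bz /rk_lt].
  have := dowling_cover_cardE bp; move: bz; rewrite /rk botE => + E.
  by rewrite subnn => bz; rewrite [X in (_ < X - _)%N]E subSnn ltnS leqNgt bz.
(* Choose a datum of the atom [p] that is not in [x] and acquire it above [w] in at most one step.
   The resulting [u] meets [p] strictly above the bottom, so the meet is [p] itself and [p <= u]. *)
- move=> w p /andP[bp /existsPn atp].
  have [e ep Neb] : exists2 e, e \in relation (val p) & e \notin relation (val bot).
    apply/subsetPn; rewrite -dowling_leE -leE.
    apply: contraL bp => pb.
    by rewrite lt_neqAle (le_anti (introT andP (conj pb (bot_le p)))) eqxx.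
  have [u [wu eu rku]] : exists u : sg,
      [/\ w <= u, e \in relation (val u) & (rk u <= (rk w).+1)%N].
    have [ew|ew] := boolP (e \in relation (val w)).
      by exists w; split.
    have [||u [wu _ eu]] := step w top e _ _ ew.
    + by rewrite topE; move: (le_y p); rewrite dowling_leE => /subsetP; apply.
    + by rewrite leE topE.
    exists u; split=> //; first by rewrite leE; apply: connect1.
    by rewrite /rk (dowling_cover_cardE wu) leq_subLR addnS -addSn -leq_subLR.
  exists u; split=> //.
  have := le_meet (meet u p) u p; rewrite lexx => /esym/andP[mu mp].
  suff pm : p = meet u p by rewrite pm.
  have em : e \in relation (val (meet u p)) by rewrite /= relation_decode inE eu ep.
  apply/eqP; apply: contraNT (atp (meet u p)) => Npm.
  rewrite !lt_neqAle mp bot_le !andbT eq_sym [meet u p == p]eq_sym Npm andbT.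
  by apply: contraNneq Neb => <-.
Qed.

End SegmentGeometric.

(** * Upper intervals *)

Section OrderIso.
Variables (d d' : Order.disp_t) (P : porderType d) (Q : porderType d').

Lemma order_iso_of_surj (f : P -> Q) :
  {mono f : x y / x <= y} -> (forall q, exists p, f p = q) -> order_iso P Q.
Proof.
move=> mono surj; have surjb q : exists p, f p == q.
  by have [p <-] := surj q; exists p.
exists f; split=> //; exists (fun q => xchoose (surjb q)) => [p|q].
  by apply: le_anti; rewrite -!mono (eqP (xchooseP (surjb (f p)))) lexx.
exact/eqP/(xchooseP (surjb q)).
Qed.

Lemma order_iso_trans d'' (R : porderType d'') :
  order_iso P Q -> order_iso Q R -> order_iso P R.
Proof.
move=> [f [bf mf]] [g [bg mg]]; exists (g \o f); split; first exact: bij_comp.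
by move=> x y; rewrite /= mg mf.
Qed.

End OrderIso.

Section Pull.
Variables (gT : finGroupType) (S : finType) (to : {action gT &-> S}).
Variables (T : finType) (tau : {set T}) (U : finType) (sigma : {set U}).
(* [p] chooses a base point for each element of [sigma]. It is partial because
   [T] may be empty while [U] is not. *)
Variable p : U -> option T.
Implicit Types (A : {set datum gT S T}) (g h : gT) (s : S).

(** The data of [A] between base points, read on their labels. *)
Definition pullset (A : {set datum gT S T}) : {set datum gT S U} :=
  [set d | match d with
    | inl (u, g, v) =>
        if p u is Some i then if p v is Some j then arc i g j \in A else false
        else false
    | inr (u, s) => if p u is Some i then hue i s \in A else false
    end].

Lemma in_pullset_arc A u g v : 
  reflect (exists i j, [/\ p u = Some i, p v = Some j & arc i g j \in A])
          (arc u g v \in pullset A).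
Proof.
rewrite inE; case: (p u) => [i|]; last by right=> -[i [j []]].
case: (p v) => [j|]; last by right=> -[? [j []]].
by apply: (iffP idP) => [ij|[k [l [[->] [->]]]]] //; exists i, j.
Qed.

Lemma in_pullset_hue A u s :
  reflect (exists2 i, p u = Some i & hue i s \in A) (hue u s \in pullset A).
Proof.
rewrite inE; case: (p u) => [i|]; last by right=> -[i].
by apply: (iffP idP) => [si|[j [->]]] //; exists i.
Qed.

Hypothesis p_dom : forall u, (u \in sigma) = isSome (p u).
Hypothesis p_tau : forall u i, p u = Some i -> i \in tau.

Lemma pullset_congruence A : congruence to tau A -> congruence to sigma (pullset A).
Proof.
move=> cA; split.
- by move=> u g v /in_pullset_arc[i [j [ui _ _]]]; rewrite p_dom ui.
- by move=> u s /in_pullset_hue[i ui _]; rewrite p_dom ui.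
- move=> u; rewrite p_dom; case ui: (p u) => [i|] // _.
  by apply/in_pullset_arc; exists i, i; split; rewrite // (cg_refl cA) ?(p_tau ui).
- move=> u g v /in_pullset_arc[i [j [ui vj ij]]].
  by apply/in_pullset_arc; exists j, i; split=> //; exact: (cg_sym cA ij).
- move=> u g v h w /in_pullset_arc[i [j [ui vj ij]]].
  case/in_pullset_arc => [j' [k [vj' wk jk]]]; apply/in_pullset_arc.
  exists i, k; split=> //; apply: (cg_trans cA ij).
  by move: vj'; rewrite vj => -[->].
- move=> u g v s /in_pullset_arc[i [j [ui vj ij]]] /in_pullset_hue[k].
  rewrite vj => -[<-] js; apply/in_pullset_hue; exists i => //.
  exact: (cg_act cA ij).
- move=> u g v s /in_pullset_hue[i ui si] /in_pullset_hue[j vj sj].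
  by apply/in_pullset_arc; exists i, j; split=> //; apply: (cg_join cA) sj.
- move=> u s t /in_pullset_hue[i ui si] /in_pullset_hue[j].
  by rewrite ui => -[<-]; apply: (cg_fun cA).
- move=> u g /in_pullset_arc[i [j [ui]]]; rewrite ui => -[<-].
  case/(cg_free cA) => [|[s si]]; [by left|right; exists s].
  by apply/in_pullset_hue; exists i.
Qed.

Definition pull (y : dowling to tau) : dowling to sigma :=
  decode (pullset_congruence (relation_congruence y)).

Lemma pull_homo : {homo pull : y z / y <= z}.
Proof.
move=> y z; rewrite !dowling_leE !relation_decode => /subsetP yz.
apply/subsetP => -[[[u g] v]|[u s]].
  by case/in_pullset_arc => i [j [ui vj /yz ij]]; apply/in_pullset_arc; exists i, j.
by case/in_pullset_hue => i ui /yz si; apply/in_pullset_hue; exists i.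
Qed.

(** * Recovering relations above [x] from their restriction to base points *)

Section Lift.
Variable x : dowling to tau.
Hypothesis p_nonzero : forall u i s, p u = Some i -> hue i s \notin relation x.
Hypothesis p_inj : forall u v i j g,
  p u = Some i -> p v = Some j -> arc i g j \in relation x -> u = v.
Hypothesis p_cover : forall i, i \in tau ->
  (forall s, hue i s \notin relation x) ->
  exists u j g, p u = Some j /\ arc i g j \in relation x.

Let cx := relation_congruence x.

(** Coordinates of a point uncolored in [x]: the label [u] of its block and its gain [h] to the base
    point. They exist by [p_cover] and are unique by [p_inj] and uniqueness of gains. *)
Let tied i h u := if p u is Some j then arc i h j \in relation x else false.

Let tiedP i h u :
  reflect (exists2 j, p u = Some j & arc i h j \in relation x) (tied i h u).
Proof.
rewrite /tied; case: (p u) => [j|]; last by right=> -[].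
by apply: (iffP idP) => [ij|[k [->]]] //; exists j.
Qed.

Let tied_tau i h u : tied i h u -> i \in tau.
Proof. by case/tiedP => j _ /(cg_arc cx). Qed.

Let tied_nonzero i h u s : tied i h u -> hue i s \notin relation x.
Proof.
case/tiedP => j uj ij; apply/negP => /(cg_act_sym cx ij); apply/negP.
exact: p_nonzero uj.
Qed.

Let tied_uniq i h k u v : tied i h u -> tied i k v -> u = v /\ h = k.
Proof.
move=> iu; have Ni s := tied_nonzero s iu; move: iu.
case/tiedP => j uj ij /tiedP[l vl il].
have uv : u = v by apply: p_inj uj vl (cg_trans cx (cg_sym cx ij) il).
split=> //; apply: (cg_gain_uniq cx ij) Ni.
by move: vl; rewrite -uv uj => -[->].
Qed.

Let tied_base u i : p u = Some i -> tied i 1 u.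
Proof. by move=> ui; rewrite /tied ui (cg_refl cx) ?(p_tau ui). Qed.

Let tied_exists i : i \in tau ->
  (exists s, hue i s \in relation x) \/ exists h u, tied i h u.
Proof.
move=> it; have [/existsP ?|/existsPn iN] := boolP [exists s, hue i s \in relation x].
  by left.
have [u [j [g [uj ij]]]] := p_cover it iN.
by right; exists g, u; apply/tiedP; exists j.
Qed.

Section LiftSet.
Variables (W : {set datum gT S U}) (cW : congruence to sigma W).

Let lift_hue i s := (hue i s \in relation x)
  || [exists u, exists h, tied i h u && (hue u (lact to h^-1 s) \in W)].

Let lift_hueP i h u s :
  tied i h u -> lift_hue i s = (hue u (lact to h^-1 s) \in W).
Proof.
move=> iu; rewrite /lift_hue (negPf (tied_nonzero s iu)) /=.
apply/existsP/idP => [[v /existsP[k /andP[iv]]]|sW].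
  by have [-> ->] := tied_uniq iu iv.
by exists u; apply/existsP; exists h; rewrite iu.
Qed.

Let lift_hue_zero i s t :
  hue i s \in relation x -> lift_hue i t -> t = s.
Proof.
move=> si /orP[ti|]; first exact: (cg_fun cx ti si).
by case/existsP => u /existsP[h /andP[/(tied_nonzero s)/negP]].
Qed.

Let lift_hue_fun i s t : lift_hue i s -> lift_hue i t -> s = t.
Proof.
case/orP => [si|]; first by move/(lift_hue_zero si).
case/existsP => u /existsP[h /andP[iu su]]; rewrite (lift_hueP _ iu) => tu.
by apply: (can_inj (lactK to h^-1)); apply: (cg_fun cW su tu).
Qed.

(** An arc with gain [g] between points with coordinates [(h, u)] and [(k, v)] passes through the
    base points, where its gain becomes [h^-1 * g * k]. The second disjunct adds the arcs between
    colored points, whether colored by [x] or through [W]. *)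
Definition liftset : {set datum gT S T} :=
  [set d | match d with
    | inl (i, g, j) =>
        [exists u, exists h, exists v, exists k,
          [&& tied i h u, tied j k v & arc u (h^-1 * g * k) v \in W]]
        || [exists s, lift_hue i (lact to g s) && lift_hue j s]
    | inr (i, s) => lift_hue i s
    end].

Lemma in_liftset_arc i g j :
  reflect ((exists u h v k,
              [/\ tied i h u, tied j k v & arc u (h^-1 * g * k) v \in W])
           \/ (exists s, hue i (lact to g s) \in liftset /\ hue j s \in liftset))
          (arc i g j \in liftset).
Proof.
rewrite inE; apply: (iffP orP); case.
- case/existsP => u /existsP[h /existsP[v /existsP[k /and3P[? ? ?]]]].
  by left; exists u, h, v, k.
- by case/existsP => s /andP[? ?]; right; exists s; rewrite !inE.
- case=> [u [h [v [k [iu jv uv]]]]]; left; apply/existsP; exists u.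
  apply/existsP; exists h; apply/existsP; exists v; apply/existsP; exists k.
  exact/and3P.
- by case=> s; rewrite !inE => si; right; apply/existsP; exists s; apply/andP.
Qed.

Lemma liftset_congruence : congruence to tau liftset.
Proof.
have hue_tau i s : hue i s \in liftset -> i \in tau.
  rewrite inE => /orP[/(cg_hue cx) //|].
  by case/existsP => u /existsP[h /andP[/tied_tau]].
have hue_fun i s t : hue i s \in liftset -> hue i t \in liftset -> s = t.
  by rewrite !inE; apply: lift_hue_fun.
have sym i g j : arc i g j \in liftset -> arc j g^-1 i \in liftset.
  case/in_liftset_arc => [[u [h [v [k [iu jv uv]]]]]|[s [si sj]]].
    apply/in_liftset_arc; left; exists v, k, u, h; split=> //.
    by have := cg_sym cW uv; rewrite !invMg invgK mulgA.
  by apply/in_liftset_arc; right; exists (lact to g s); rewrite lactK.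
have act i g j s : arc i g j \in liftset -> hue j s \in liftset ->
    hue i (lact to g s) \in liftset.
  case/in_liftset_arc => [[u [h [v [k [iu jv uv]]]]]|[t [ti tj]] sj].
    rewrite !inE (lift_hueP _ jv) (lift_hueP _ iu) => /(cg_act cW uv).
    by rewrite -!lactM -!mulgA mulgV mulg1.
  by rewrite (hue_fun j s t).
split=> //.
- move=> i g j /in_liftset_arc[[u [h [v [k [/tied_tau]]]]]|[s [/hue_tau]]] //.
- move=> i it; apply/in_liftset_arc; case: (tied_exists it) => [[s si]|[h [u iu]]].
    by right; exists s; rewrite lact1 inE /lift_hue si.
  left; exists u, h, u, h; rewrite mulg1 mulVg; split=> //; apply: (cg_refl cW).
  by case/tiedP: iu => j uj _; rewrite p_dom uj.
- move=> i g j h k ij jk.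
  case/in_liftset_arc: (ij) => [[u [a [v [b [iu jv uv]]]]]|[s [si sj]]]; last first.
    apply/in_liftset_arc; right; exists (lact to h^-1 s).
    by rewrite lactM lactKV; split=> //; apply: act sj; apply: sym.
  case/in_liftset_arc: (jk) => [[v' [b' [w [c [jv' kw vw]]]]]|[s [sj sk]]]; last first.
    apply/in_liftset_arc; right; exists s; rewrite lactM; split=> //.
    exact: act ij sj.
  apply/in_liftset_arc; left; exists u, a, w, c; split=> //.
  have [ev eb] := tied_uniq jv jv'; subst v' b'.
  by have := cg_trans cW uv vw; rewrite !mulgA mulgK.
- by move=> i g j s si sj; apply/in_liftset_arc; right; exists s.
- move=> i g /in_liftset_arc[[u [h [v [k [iu iv uv]]]]]|[s [_ si]]]; last first.
    by right; exists s.
  have [uv' hk] := tied_uniq iu iv; subst v k.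
  (* The loop at [u] is a conjugate of [g], so it is trivial only if [g] is. *)
  case: (cg_free cW uv) => [/eqP|[s su]].
    by rewrite -mulgA -conjgE conjg_eq1 => /eqP; left.
  by right; exists (lact to h s); rewrite inE (lift_hueP _ iu) lactK.
Qed.

Lemma sub_liftset : relation x \subset liftset.
Proof.
have cL := liftset_congruence.
have hueL i s : hue i s \in relation x -> hue i s \in liftset.
  by move=> si; rewrite inE /lift_hue si.
apply/subsetP => -[[[i g] j]|[i s]] ij; last exact: hueL.
have jt := cg_arcr cx ij.
case: (tied_exists jt) => [[s sj]|[k [v jv]]].
  by apply: (cg_join cL) (hueL _ _ sj); apply: hueL; exact: (cg_act cx ij sj).
(* Both ends of an arc of [x] share their base point, and the gain left there is 1. *)
apply/in_liftset_arc; left; exists v, (g * k), v, k; split=> //.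
  case/tiedP: jv => l vl jl; apply/tiedP; exists l => //.
  exact: (cg_trans cx ij jl).
rewrite -mulgA mulVg; apply: (cg_refl cW).
by case/tiedP: jv => l vl _; rewrite p_dom vl.
Qed.

Lemma pullset_liftset : pullset liftset = W.
Proof.
have cL := liftset_congruence.
have hueE u i s : p u = Some i -> (hue i s \in liftset) = (hue u s \in W).
  by move=> ui; rewrite inE (lift_hueP _ (tied_base ui)) invg1 lact1.
have pW u : u \in sigma -> exists i, p u = Some i.
  by rewrite p_dom; case: (p u) => // i; exists i.
apply/setP => -[[[u g] v]|[u s]]; last first.
  apply/in_pullset_hue/idP => [[i ui]|su]; first by rewrite (hueE _ _ _ ui).
  by have [i ui] := pW u (cg_hue cW su); exists i; rewrite ?(hueE _ _ _ ui).
apply/in_pullset_arc/idP => [[i [j [ui vj]]]|uv].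
  case/in_liftset_arc => [[u' [h [v' [k [iu jv uv]]]]]|[s []]].
    have [? ?] := tied_uniq (tied_base ui) iu; subst u' h.
    have [? ?] := tied_uniq (tied_base vj) jv; subst v' k.
    by rewrite invg1 mul1g mulg1 in uv.
  by rewrite (hueE _ _ _ ui) (hueE _ _ _ vj); apply: (cg_join cW).
have [i ui] := pW u (cg_arc cW uv); have [j vj] := pW v (cg_arcr cW uv).
exists i, j; split=> //; apply/in_liftset_arc; left; exists u, 1, v, 1.
by rewrite invg1 mul1g mulg1; split=> //; apply: tied_base.
Qed.

End LiftSet.

Lemma pull_mono y z : x <= y -> x <= z -> (pull y <= pull z) = (y <= z).
Proof.
move=> xy xz; apply/idP/idP; last exact: pull_homo.
rewrite !dowling_leE !relation_decode in xy xz *.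
move/subsetP: xy => xy; move/subsetP: xz => xz /subsetP yz.
have cy := relation_congruence y; have cz := relation_congruence z.
have hueP i s : hue i s \in relation y -> hue i s \in relation z.
  move=> si; case: (tied_exists (cg_hue cy si)) => [[t ti]|[h [u]]].
    by rewrite (cg_fun cy si (xy _ ti)); apply: xz.
  case/tiedP => j uj ij.
  have : hue u (lact to h^-1 s) \in pullset (relation z).
    apply: yz; apply/in_pullset_hue; exists j => //.
    exact: (cg_act_sym cy (xy _ ij)).
  case/in_pullset_hue => j'; rewrite uj => -[<-] /(cg_act cz (xz _ ij)).
  by rewrite lactKV.
apply/subsetP => -[[[i g] j]|[i s]] ij; last exact: hueP.
have zero_case s : hue j s \in relation y -> arc i g j \in relation z.
  move=> sj; apply: (cg_join cz) (hueP _ _ sj); apply: hueP.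
  exact: (cg_act cy ij sj).
case: (tied_exists (cg_arcr cy ij)) => [[s /xy sj]|[k [v]]]; first exact: zero_case sj.
case: (tied_exists (cg_arc cy ij)) => [[s /xy si]|[h [u]]].
  by move=> _; apply: zero_case (cg_act_sym cy ij si).
case/tiedP=> a ua ia /tiedP[b vb jb].
(* An arc of [y] is a composite of arcs of [x] to and from base points with an arc between base
   points. The former lie in [z] because [x <= z], the latter by comparison of the restrictions. *)
have : arc u (h^-1 * g * k) v \in pullset (relation z).
  apply: yz; apply/in_pullset_arc; exists a, b; split=> //.
  apply: (cg_trans cy _ (xy _ jb)); apply: (cg_trans cy _ ij).
  by apply: (cg_sym cy); apply: xy.
case/in_pullset_arc => a' [b' []]; rewrite ua vb => -[<-] [<-] ab.
have := cg_div cz (cg_trans cz (xz _ ia) ab) (xz _ jb).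
by rewrite -!mulgA mulgV mulg1 mulKVg.
Qed.

Lemma pull_surj w : exists2 y, x <= y & pull y = w.
Proof.
have cw := relation_congruence w.
exists (decode (liftset_congruence cw)).
  by rewrite dowling_leE relation_decode sub_liftset.
by apply: relation_inj; rewrite !relation_decode pullset_liftset.
Qed.

Lemma upset_iso_pull : order_iso (upset x) (dowling to sigma).
Proof.
apply: (@order_iso_of_surj _ _ _ _ (fun y : upset x => pull (val y))).
  by move=> y z; rewrite pull_mono ?leEsub //; apply: valP.
by move=> w; have [y xy <-] := pull_surj w; exists (exist _ y xy).
Qed.

(** Cutting the isomorphism of upper intervals at [y] reduces the study of arbitrary intervals to
    that of lower ones. *)
Lemma segment_iso_pull y : x <= y ->
  order_iso (segment x y) (downset (pull y)).
Proof.
move=> xy; have pz (z : segment x y) : pull (val z) <= pull y.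
  by apply: pull_homo; case/andP: (valP z).
apply: (@order_iso_of_surj _ _ _ _
  (fun z : segment x y => exist _ (pull (val z)) (pz z) : downset (pull y))).
  move=> z t; rewrite !leEsub /= pull_mono //.
    by case/andP: (valP z).
  by case/andP: (valP t).
move=> w; have [z xz zw] := pull_surj (val w).
have zy : z <= y by rewrite -pull_mono // zw (valP w).
by exists (exist _ z (introT andP (conj xz zy))); apply: val_inj.
Qed.

End Lift.
End Pull.

(** * Lower intervals *)

Section SetPartitions.
Variables (T : finType) (A : {set T}).
Implicit Types P Q : setpart A.

Lemma mem_setpart_block P u : u \in A -> u \in pblock (val P) u.
Proof. by move=> uA; rewrite mem_pblock (cover_partition (valP P)). Qed.

Lemma setpart_block_sub P u v : v \in pblock (val P) u -> u \in A /\ v \in A.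
Proof.
have inA z : z \in cover (val P) -> z \in A by rewrite (cover_partition (valP P)).
rewrite /pblock; case: pickP => [B /andP[PB uB] vB|_]; last by rewrite inE.
by split; apply/inA/bigcupP; exists B.
Qed.

Lemma setpart_blockP P u v :
  v \in pblock (val P) u -> pblock (val P) v = pblock (val P) u.
Proof. by have /and3P[_ tiP _] := valP P; apply: same_pblock. Qed.

(** Refinement as inclusion of equivalence relations. Points off [A] need no hypothesis, since their
    [pblock] is empty. *)
Lemma setpart_leP P Q :
  reflect (forall u v, v \in pblock (val P) u -> v \in pblock (val Q) u) (P <= Q).
Proof.
have /and3P[_ tiP P0] := valP P; have /and3P[_ tiQ _] := valP Q.
apply: (iffP forall_inP) => [PQ u v vu|PQ B PB].
  have [uA _] := setpart_block_sub vu.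
  have {}uA : u \in cover (val P) by rewrite (cover_partition (valP P)).
  have /exists_inP[C QC /subsetP BC] := PQ _ (pblock_mem uA).
  rewrite (def_pblock tiQ QC); first exact: BC.
  by apply: BC; rewrite mem_pblock.
have /set0Pn[u uB] : B != set0 by apply: contraNneq P0 => <-.
have BE := def_pblock tiP PB uB.
have /PQ uQ : u \in pblock (val P) u by rewrite BE.
apply/exists_inP; exists (pblock (val Q) u).
  by apply: pblock_mem; rewrite -mem_pblock.
by apply/subsetP => v vB; apply: PQ; rewrite BE.
Qed.

Lemma setpart_ext P Q :
  (forall u v, (v \in pblock (val P) u) = (v \in pblock (val Q) u)) -> P = Q.
Proof.
by move=> PQ; apply: le_anti; apply/andP; split; apply/setpart_leP => u v;
  rewrite PQ.
Qed.

End SetPartitions.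

Section Orbits.
Variables (gT : finGroupType) (S : finType) (to : {action gT &-> S}).
Implicit Types o : {o : {set S} | o \in orbits to}.

Lemma orbits_lact o g s : s \in val o -> lact to g s \in val o.
Proof.
have /imsetP[t _ ->] := valP o.
by move=> /orbitP[a _ <-]; rewrite /lact -actM mem_orbit ?inE.
Qed.

Lemma orbits_trans o s t : s \in val o -> t \in val o -> exists g, t = lact to g s.
Proof.
have /imsetP[r _ ->] := valP o.
(* The outer inverse is there because the left action of [g] is the right action of [g^-1]. *)
move=> /orbitP[a _ <-] /orbitP[b _ <-]; exists (a^-1 * b)^-1.
by rewrite /lact invgK -actM mulKVg.
Qed.

Lemma orbits_cover s : exists o, s \in val o.
Proof.
have os : orbit to [set: gT] s \in orbits to by apply/imsetP; exists s; rewrite ?inE.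
by exists (exist (fun o : {set S} => o \in orbits to) _ os); apply: orbit_refl.
Qed.

Lemma orbits_uniq o o' s : s \in val o -> s \in val o' -> o = o'.
Proof.
move=> so so'; apply: val_inj; move: so so'.
have /imsetP[t _ ->] := valP o; have /imsetP[r _ ->] := valP o'.
by move=> /orbit_eqP <- /orbit_eqP <-.
Qed.

Lemma lact_stabP g s : reflect (lact to g s = s) (g \in 'C[s | to]).
Proof. by rewrite -groupV; apply: astab1P. Qed.

End Orbits.

(** * The lower interval of [e], with blocks [B] and color classes [C] *)

Section DownsetIso.
Variables (gT : finGroupType) (S : finType) (to : {action gT &-> S}).
Variables (s : {o : {set S} | o \in orbits to} -> S).
Hypothesis s_rep : forall o, s o \in val o.
Variables (T : finType) (tau : {set T}) (e : dowling to tau).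
Variables (I : finType) (B : I -> {set T}).
Variable C : {o : {set S} | o \in orbits to} -> {set T}.

Hypothesis B_connected : forall i u v,
  u \in B i -> v \in B i -> exists g, arc u g v \in relation e.
Hypothesis B_closed : forall i u v g,
  u \in B i -> arc u g v \in relation e -> v \in B i.
Hypothesis B_nonzero : forall i u t, u \in B i -> hue u t \notin relation e.
Hypothesis B_cover : forall u, u \in tau ->
  (forall t, hue u t \notin relation e) -> exists i, u \in B i.
Hypothesis B_disjoint : forall i j u, u \in B i -> u \in B j -> i = j.
Hypothesis C_zero : forall o u,
  u \in C o <-> exists2 t, t \in val o & hue u t \in relation e.

Local Notation orb := {o : {set S} | o \in orbits to}.
Local Notation stab o := [subg 'C[s o | to]]%type.

Let ce := relation_congruence e.

Let B_tau i u : u \in B i -> u \in tau.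
Proof. by move=> uB; have [g /(cg_arc ce)] := B_connected uB uB. Qed.

Let C_tau o u : u \in C o -> u \in tau.
Proof. by move=> /C_zero[t _ /(cg_hue ce)]. Qed.

Let tau_cases u : u \in tau -> (exists i, u \in B i) \/ exists o, u \in C o.
Proof.
move=> ut; have [/existsP[t tu]|/existsPn uN] :=
  boolP [exists t, hue u t \in relation e].
  by have [o to_] := orbits_cover to t; right; exists o; apply/C_zero; exists t.
by left; apply: B_cover.
Qed.

Let B_not_C i o u : u \in B i -> u \in C o -> False.
Proof. by move=> uB /C_zero[t _]; rewrite (negPf (B_nonzero t uB)). Qed.

Let C_disjoint o o' u : u \in C o -> u \in C o' -> o = o'.
Proof.
move=> /C_zero[t to_ ut] /C_zero[r ro ur].
by apply: orbits_uniq to_ _; rewrite (cg_fun ce ut ur).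
Qed.

(* [frame o u] carries the representative [s o] to the color of [u]; its value
   off [C o] is irrelevant. *)
Definition frame o u : gT :=
  odflt 1 [pick g | hue u (lact to g (s o)) \in relation e].

Lemma frameP o u : u \in C o -> hue u (lact to (frame o u) (s o)) \in relation e.
Proof.
case/C_zero => t to_ ut; rewrite /frame; case: pickP => [//|/= N].
by have [g tE] := orbits_trans (s_rep o) to_; have := N g; rewrite -tE ut.
Qed.

Let hue_frame o u t : u \in C o -> hue u t \in relation e ->
  t = lact to (frame o u) (s o).
Proof. by move=> /frameP uC ut; exact: (cg_fun ce ut uC). Qed.

(** The gain obtained by carrying the color of [v] to [s o], applying [h], and carrying the result
    to the color of [u]; for [h] in the stabilizer it is a gain of [e]. *)
Definition transport o u (h : gT) v := frame o u * h * (frame o v)^-1.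

Let stab_fix o (h : stab o) : lact to (sgval h) (s o) = s o.
Proof. by apply/lact_stabP; apply: subgP. Qed.

Lemma transport_arc o u v (h : stab o) : u \in C o -> v \in C o ->
  arc u (transport o u (sgval h) v) v \in relation e.
Proof.
move=> uC vC; apply: (cg_join ce) (frameP vC).
by rewrite !lactM lactK stab_fix; apply: frameP.
Qed.

Lemma arc_transport o u v g : u \in C o -> arc u g v \in relation e ->
  v \in C o /\ exists h : stab o, g = transport o u (sgval h) v.
Proof.
move=> uC uv; have vu := cg_act_sym ce uv (frameP uC).
have vC : v \in C o.
  by apply/C_zero; exists (lact to g^-1 (lact to (frame o u) (s o))) => //; 
    do 2!apply: orbits_lact.
(* This product carries [s o] to the color of [v], then to that of [u], then back to [s o]. *)
split=> //; have hS : (frame o u)^-1 * g * frame o v \in 'C[s o | to].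
  apply/lact_stabP; rewrite !lactM -(hue_frame vC vu) lactKV.
  by rewrite lactK.
exists (subg _ ((frame o u)^-1 * g * frame o v)); rewrite subgK //.
by rewrite /transport -!mulgA mulgV mulg1 mulKVg.
Qed.

Section Restriction.
Variables (w : dowling to tau) (we : w <= e).
Let cw := relation_congruence w.
Let sub_we : {subset relation w <= relation e}.
Proof. by apply/subsetP; rewrite -dowling_leE. Qed.

(** Forgetting gains loses nothing on a block of [e]: the gains of [w] there are those of [e], which
    are unique. *)
Definition tied u v := [exists g, arc u g v \in relation w].

Lemma tied_equivalence i : {in B i & &, equivalence_rel tied}.
Proof.
move=> u v z uB vB zB; split.
  by apply/existsP; exists 1; apply: (cg_refl cw); exact: (@B_tau i).
case/existsP => g uv; apply/existsP/existsP => -[h h_arc].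
  by exists (g^-1 * h); apply: (cg_trans cw _ h_arc); apply: (cg_sym cw).
by exists (g * h); apply: (cg_trans cw uv).
Qed.

Definition block_part i : setpart (B i) :=
  exist _ (equivalence_partition tied (B i))
    (equivalence_partitionP (@tied_equivalence i)).

Lemma block_partE i u v :
  (v \in pblock (val (block_part i)) u) = [&& u \in B i, v \in B i & tied u v].
Proof.
apply/idP/and3P => [vu|[uB vB uv]]; last first.
  by rewrite (pblock_equivalence_partition (@tied_equivalence i)).
have [uB vB] := setpart_block_sub vu; split=> //.
by rewrite -(pblock_equivalence_partition (@tied_equivalence i)).
Qed.

(** On the color class of [o], the colors of [w] are dictated by [e]; what remains is which points
    are colored, so a one-point set of colors suffices. *)
Definition zero_set o : {set datum (stab o) unit T} :=
  [set d | match d with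
    | inl (u, h, v) =>
        [&& u \in C o, v \in C o &
            arc u (transport o u (sgval h) v) v \in relation w]
    | inr (u, _) => (u \in C o) && [exists t, hue u t \in relation w]
    end].

Lemma in_zero_set_arc o u h v : arc u h v \in zero_set o =
  [&& u \in C o, v \in C o & arc u (transport o u (sgval h) v) v \in relation w].
Proof. by rewrite inE. Qed.

Lemma in_zero_set_hue o u : hue u tt \in zero_set o =
  (u \in C o) && [exists t, hue u t \in relation w].
Proof. by rewrite inE. Qed.

Lemma zero_set_congruence o : congruence (unit_action _) (C o) (zero_set o).
Proof.
split.
- by move=> u h v; rewrite in_zero_set_arc => /and3P[].
- by move=> u []; rewrite in_zero_set_hue => /andP[].
- move=> u uC; rewrite in_zero_set_arc uC /transport /= mulg1 mulgV.
  by apply: (cg_refl cw); apply: C_tau uC.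
- move=> u h v; rewrite !in_zero_set_arc => /and3P[-> -> /(cg_sym cw)] /=.
  by rewrite /transport !invMg invgK mulgA.
- move=> u g v h z; rewrite !in_zero_set_arc => /and3P[-> -> uv] /and3P[_ -> vz] /=.
  by have := cg_trans cw uv vz; rewrite /transport !mulgA mulgKV.
- move=> u h v []; rewrite in_zero_set_arc !in_zero_set_hue.
  case/and3P=> -> _ uv /andP[_ /existsP[t vt]] /=.
  apply/existsP; exists (lact to (transport o u (sgval h) v) t).
  exact: (cg_act cw uv vt).
- move=> u h v []; rewrite in_zero_set_arc !in_zero_set_hue.
  case/andP=> uC /existsP[t ut] /andP[vC /existsP[r vr]]; rewrite uC vC.
  apply: (cg_join cw) (vr); rewrite (hue_frame vC (sub_we vr)) !lactM lactK stab_fix.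
  by rewrite -(hue_frame uC (sub_we ut)).
- by move=> u [] [].
- move=> u h; rewrite in_zero_set_arc => /and3P[uC _ /(cg_free cw)].
  case=> [/eqP|[t ut]]; last first.
    by right; exists tt; rewrite in_zero_set_hue uC; apply/existsP; exists t.
  rewrite /transport -eq_mulgV1 -{2}[frame o u]mulg1 => /eqP/mulgI h1.
  by left; apply: subg_inj.
Qed.

Definition zero_part o : dowling_lattice (stab o) (C o) :=
  decode (zero_set_congruence o).

End Restriction.

(** * Gluing set partitions and Dowling lattice elements *)

Section Gluing.
Variables (P : forall i, setpart (B i)).
Variables (D : forall o, dowling_lattice (stab o) (C o)).
Let cD o := relation_congruence (D o).

(** Inside a block of [e] the partition decides which points are tied and [e] supplies the gains;
    inside a color class [D] decides the gains, up to transport, and [e] supplies the colors. *)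
Definition glue : {set datum gT S T} :=
  [set d | match d with
    | inl (u, g, v) => (arc u g v \in relation e)
        && ([exists i, v \in pblock (val (P i)) u]
            || [exists o, exists h : stab o,
                  (g == transport o u (sgval h) v)
                  && (arc u h v \in relation (D o))])
    | inr (u, t) => (hue u t \in relation e)
        && [exists o, hue u tt \in relation (D o)]
    end].

Lemma in_glue_arc u g v :
  reflect (arc u g v \in relation e /\
           ((exists i, v \in pblock (val (P i)) u)
            \/ exists o (h : stab o), g = transport o u (sgval h) v
                 /\ arc u h v \in relation (D o)))
          (arc u g v \in glue).
Proof.
rewrite [X in reflect _ X]inE; apply: (iffP andP) => -[uv H]; split=> //.
  case/orP: H => [/existsP ?|/existsP[o /existsP[h /andP[/eqP ? ?]]]]; first by left.
  by right; exists o, h.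
case: H => [?|[o [h [gE ?]]]]; apply/orP; first by left; apply/existsP.
by right; apply/existsP; exists o; apply/existsP; exists h; rewrite gE eqxx.
Qed.

Lemma in_glue_hue u t :
  reflect (hue u t \in relation e /\ exists o, hue u tt \in relation (D o))
          (hue u t \in glue).
Proof.
rewrite [X in reflect _ X]inE.
by apply: (iffP andP) => -[ut]; [move/existsP|move/existsP=> uD].
Qed.

Lemma glue_hue_in o u t : u \in C o -> hue u t \in glue -> hue u tt \in relation (D o).
Proof.
move=> uC /in_glue_hue[_ [o' u']].
by rewrite (C_disjoint uC (cg_hue (cD o') u')).
Qed.

Lemma glue_arc_block i u g v : u \in B i -> arc u g v \in glue ->
  v \in pblock (val (P i)) u.
Proof.
move=> uB /in_glue_arc[_ [[j vu]|[o [h [_ uv]]]]].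
  by rewrite (B_disjoint uB (setpart_block_sub vu).1).
by case: (B_not_C uB (cg_arc (cD o) uv)).
Qed.

Lemma glue_arc_zero o u g v : u \in C o -> arc u g v \in glue ->
  exists2 h : stab o, g = transport o u (sgval h) v & arc u h v \in relation (D o).
Proof.
move=> uC /in_glue_arc[_ [[i vu]|[o' [h [gE uv]]]]].
  by case: (B_not_C (setpart_block_sub vu).1 uC).
have oo := C_disjoint uC (cg_arc (cD o') uv); subst o'.
by exists h.
Qed.

Lemma glue_congruence : congruence to tau glue.
Proof.
have hue_uC u t : hue u t \in relation e -> exists o, u \in C o.
  by move=> ut; have [o to_] := orbits_cover to t; exists o; apply/C_zero; exists t.
split.
- by move=> u g v /in_glue_arc[/(cg_arc ce)].
- by move=> u t /in_glue_hue[/(cg_hue ce)].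
- move=> u ut; apply/in_glue_arc; split; first exact: (cg_refl ce).
  case: (tau_cases ut) => [[i uB]|[o uC]]; [left|right].
    by exists i; apply: mem_setpart_block.
  exists o, 1; split; first by rewrite /transport mulg1 mulgV.
  exact: (cg_refl (cD o)).
- move=> u g v /in_glue_arc[uv H]; apply/in_glue_arc; split; first exact: (cg_sym ce).
  case: H => [[i vu]|[o [h [gE uvD]]]]; [left|right].
    exists i; rewrite (setpart_blockP vu).
    by apply: mem_setpart_block; case: (setpart_block_sub vu).
  exists o, h^-1; split; last exact: (cg_sym (cD o)).
  by rewrite gE /transport !invMg invgK mulgA.
- move=> u g v h z uvG vzG; have /in_glue_arc[uv H] := uvG.
  have /in_glue_arc[vz _] := vzG.
  apply/in_glue_arc; split; first exact: (cg_trans ce uv).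
  case: H => [[i vu]|[o [a [gE uvD]]]]; [left|right].
    exists i; have [_ vB] := setpart_block_sub vu.
    by rewrite -(setpart_blockP vu) (glue_arc_block vB vzG).
  have vC := cg_arcr (cD o) uvD; have [b hE vzD] := glue_arc_zero vC vzG.
  exists o, (a * b); split; last exact: (cg_trans (cD o) uvD).
  by rewrite gE hE /transport !mulgA mulgKV.
- move=> u g v t uvG vtG; have /in_glue_arc[uv _] := uvG.
  have /in_glue_hue[vt _] := vtG.
  apply/in_glue_hue; split; first exact: (cg_act ce uv).
  have [o uC] := hue_uC _ _ (cg_act ce uv vt); exists o.
  have [h _ uvD] := glue_arc_zero uC uvG.
  have vC := cg_arcr (cD o) uvD.
  exact: (cg_act (cD o) uvD (glue_hue_in vC vtG)).
- move=> u g v t utG vtG.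
  have /in_glue_hue[ut _] := utG; have /in_glue_hue[vt _] := vtG.
  have uv := cg_join ce ut vt; apply/in_glue_arc; split=> //; right.
  (* The arc is in [e], hence the transport of some [h]. As both ends lie in the zero block of
     [D o], they are related there by every element of the stabilizer. *)
  have [o uC] := hue_uC _ _ ut; have [vC [h gE]] := arc_transport uC uv.
  exists o, h; split=> //; apply: (cg_join (cD o) (s := tt)).
    exact: glue_hue_in utG.
  exact: glue_hue_in vtG.
- by move=> u t r /in_glue_hue[ut _] /in_glue_hue[ur _]; apply: (cg_fun ce ut ur).
- move=> u g uuG; have /in_glue_arc[uu _] := uuG.
  have [|[t ut]] := cg_free ce uu; first by left.
  have [o uC] := hue_uC _ _ ut; have [h gE uuD] := glue_arc_zero uC uuG.
  have [h1|[[] uD]] := cg_free (cD o) uuD.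
    by left; rewrite gE h1 /transport mulg1 mulgV.
  by right; exists t; apply/in_glue_hue; split=> //; exists o.
Qed.

Lemma glue_sub : relation (decode glue_congruence) \subset relation e.
Proof.
rewrite relation_decode; apply/subsetP => -[[[u g] v]|[u t]].
  by case/in_glue_arc.
by case/in_glue_hue.
Qed.

Lemma block_part_glue i : block_part (decode glue_congruence) i = P i.
Proof.
apply: setpart_ext => u v; rewrite block_partE /tied relation_decode.
apply/and3P/idP => [[uB vB /existsP[g]]|vu]; first exact: glue_arc_block.
have [uB vB] := setpart_block_sub vu; split=> //.
have [g uv] := B_connected uB vB; apply/existsP; exists g.
by apply/in_glue_arc; split=> //; left; exists i.
Qed.

Lemma zero_set_glue o : zero_set (decode glue_congruence) o = relation (D o).
Proof.
apply/setP => -[[[u h] v]|[u []]].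
  rewrite in_zero_set_arc relation_decode.
  apply/and3P/idP => [[uC vC /(glue_arc_zero uC)[h' hE uv]]|uv].
    by have /mulIg/mulgI/subg_inj -> := hE.
  have uC := cg_arc (cD o) uv; have vC := cg_arcr (cD o) uv; split=> //.
  apply/in_glue_arc; split; first exact: transport_arc.
  by right; exists o, h.
rewrite in_zero_set_hue relation_decode.
apply/andP/idP => [[uC /existsP[t /(glue_hue_in uC)]]//|uD].
have uC := cg_hue (cD o) uD; split=> //.
apply/existsP; exists (lact to (frame o u) (s o)).
by apply/in_glue_hue; split; [apply: frameP|exists o].
Qed.

End Gluing.

(** Restricting to blocks and color classes is inverted by gluing. The families [B] and [C] are kept
    abstract so that the result applies both to subsets of the ground set and to sets of labels. *)
Theorem downset_iso :
  order_iso (downset e)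
    (fprod_poset (fun i => setpart (B i))
     *p fprod_poset (fun o => dowling_lattice (stab o) (C o))).
Proof.
pose f (w : downset e) :
    fprod_poset (fun i => setpart (B i))
    *p fprod_poset (fun o => dowling_lattice (stab o) (C o)) :=
  (finfun (fun i => block_part (val w) i),
   finfun (fun o => zero_part (valP w) o)).
apply: (@order_iso_of_surj _ _ _ _ f) => [w w'|[P D]]; last first.
  have le : decode (glue_congruence P D) <= e by rewrite dowling_leE glue_sub.
  exists (exist (fun w => w <= e) _ le); congr (_, _); apply/ffunP => i; rewrite ffunE /=.
    exact: block_part_glue.
  by apply: relation_inj; rewrite relation_decode /= zero_set_glue.
have we : val w <= e := valP w; have we' : val w' <= e := valP w'.
have sub : {subset relation (val w) <= relation e}.
  by apply/subsetP; rewrite -dowling_leE.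
have sub' : {subset relation (val w') <= relation e}.
  by apply/subsetP; rewrite -dowling_leE.
rewrite leEsub dowling_leE; apply/andP/idP => /= [[/forallP le1 /forallP le2]|].
  apply/subsetP => -[[[u g] v]|[u t]] ue.
    case: (tau_cases (cg_arc ce (sub _ ue))) => [[i uB]|[o uC]].
      have vB := B_closed uB (sub _ ue); have := le1 i; rewrite !ffunE.
      move=> /setpart_leP/(_ u v); rewrite !block_partE uB vB /=.
      case/(_ _)/existsP => [|h uv]; first by apply/existsP; exists g.
      (* The partitions only show that [w'] ties the two points; its gain agrees with that of [w]
         because both are gains of [e] at an uncolored point. *)
      rewrite (cg_gain_uniq ce (sub _ ue) (sub' _ uv)) // => t.
      exact: B_nonzero uB.
    have [vC [h gE]] := arc_transport uC (sub _ ue).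
    have := le2 o; rewrite !ffunE dowling_leE !relation_decode.
    move/subsetP/(_ (arc u h v)); rewrite !in_zero_set_arc uC vC -gE.
    exact.
  have [o to_] := orbits_cover to t.
  have uC : u \in C o by apply/C_zero; exists t => //; apply: sub.
  have := le2 o; rewrite !ffunE dowling_leE !relation_decode.
  move/subsetP/(_ (hue u tt)); rewrite !in_zero_set_hue uC /=.
  case/(_ _)/existsP => [|r ur]; first by apply/existsP; exists t.
  by rewrite (cg_fun ce (sub _ ue) (sub' _ ur)).
move/subsetP => ww'; split; apply/forallP; [move=> i|move=> o]; rewrite !ffunE.
  apply/setpart_leP => u v; rewrite !block_partE => /and3P[-> -> /existsP[g uv]].
  by apply/existsP; exists g; apply: ww'.
rewrite dowling_leE !relation_decode; apply/subsetP => -[[[u h] v]|[u []]].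
  by rewrite !in_zero_set_arc => /and3P[-> -> /ww' ->].
rewrite !in_zero_set_hue => /andP[-> /existsP[t /ww' ut]].
by apply/existsP; exists t.
Qed.

End DownsetIso.

(** * General intervals *)

Section Blocks.
Variables (gT : finGroupType) (S : finType) (to : {action gT &-> S}).
Variables (T : finType) (tau : {set T}) (y : dowling to tau).
Implicit Types (B : {set T}) (i j : T) (g : gT).

Let at_ := dowling_atlas y.

Lemma underlying_partitionP B :
  reflect (exists2 b : coloring T gT, pclass b \in blocks y & B = pdom b)
          (B \in underlying_partition y).
Proof.
apply: (iffP imsetP) => [[bt bty ->]|[b by_ ->]].
  have [b btE] := atlas_class at_ bty; subst bt.
  by exists b; rewrite ?underlying_pclass.
by exists (pclass b); rewrite ?underlying_pclass.
Qed.

Lemma block_point B : B \in underlying_partition y -> exists i, i \in B.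
Proof.
case/underlying_partitionP => b /(atlas_point at_)[i bi] ->.
by exists i; rewrite in_pdom.
Qed.

Lemma block_connected B i j : B \in underlying_partition y ->
  i \in B -> j \in B -> exists g, arc i g j \in relation y.
Proof.
case/underlying_partitionP => b by_ ->; rewrite !in_pdom.
case bi: (b i) => [h|] // _; case bj: (b j) => [k|] // _.
by exists (h * k^-1); rewrite -(block_coloringE by_ bj) bi.
Qed.

Lemma block_closed B i j g : B \in underlying_partition y ->
  i \in B -> arc i g j \in relation y -> j \in B.
Proof.
case/underlying_partitionP => b by_ ->; rewrite !in_pdom.
case bi: (b i) => [h|] // _ /(cg_sym (relation_congruence y)).
by rewrite -[g^-1](mulgK h) -(block_coloringE by_ bi) => /eqP ->.
Qed.

Lemma block_nonzero B i t : B \in underlying_partition y ->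
  i \in B -> hue i t \notin relation y.
Proof.
case/underlying_partitionP => b by_ ->; rewrite in_pdom in_relation_hue => bi.
by rewrite (atlas_nonzero at_ by_ bi).
Qed.

Lemma block_cover i : i \in tau -> (forall t, hue i t \notin relation y) ->
  exists2 B, B \in underlying_partition y & i \in B.
Proof.
move=> it /zero_coloring_None /(atlas_cover at_ it)[b by_ bi].
by exists (pdom b); rewrite ?in_pdom //; apply/underlying_partitionP; exists b.
Qed.

Lemma block_disjoint B B' i : B \in underlying_partition y ->
  B' \in underlying_partition y -> i \in B -> i \in B' -> B = B'.
Proof.
case/underlying_partitionP => b by_ -> /underlying_partitionP[c cy ->].
rewrite !in_pdom => bi ci; rewrite -!underlying_pclass.
by rewrite (atlas_eq at_ by_ cy bi ci).
Qed.

Lemma in_zero_preim (o : {set S}) i :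
  i \in zero_preim y o <-> exists2 t, t \in o & hue i t \in relation y.
Proof.
rewrite inE; case iE: (zero_coloring y i) => [t|]; split=> //.
- by move=> to_; exists t; rewrite // in_relation_hue iE.
- by case=> r ro; rewrite in_relation_hue iE => /eqP[->].
- by case=> r _; rewrite in_relation_hue iE.
Qed.

Lemma zero_preim_closed (o : {o | o \in orbits to}) i j g :
  i \in zero_preim y (val o) -> arc i g j \in relation y ->
  j \in zero_preim y (val o).
Proof.
case/in_zero_preim => t to_ it ij; apply/in_zero_preim.
exists (lact to g^-1 t); first exact: orbits_lact.
exact: (cg_act_sym (relation_congruence y) ij it).
Qed.

End Blocks.

(** * Intervals above [x] in terms of labelled blocks *)

Section MainIsomorphisms.
Variables (gT : finGroupType) (S : finType) (to : {action gT &-> S}).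
Variables (T : finType) (tau : {set T}).

Section Labels.
Variables (x : dowling to tau) (U : finType) (sigma : {set U}).
Variable label : U -> {set T}.
Hypothesis label_block :
  {in sigma, forall u, label u \in underlying_partition x}.
Hypothesis label_inj : {in sigma &, injective label}.
Hypothesis label_surj : forall B, B \in underlying_partition x ->
  exists2 u, u \in sigma & label u = B.

(** A point chosen in each labelled block. Arbitrary labels allow a block of [x] to be represented
    by its underlying set or by its projectivized coloring. *)
Definition base_point u : option T :=
  if u \in sigma then [pick i in label u] else None.

Lemma base_point_dom u : (u \in sigma) = isSome (base_point u).
Proof.
rewrite /base_point; case: ifP => // us; case: pickP => // N.
by have [i] := block_point (label_block us); rewrite N.
Qed.

Lemma base_pointP u i : base_point u = Some i -> u \in sigma /\ i \in label u.
Proof. by rewrite /base_point; case: ifP => // us; case: pickP => // j ? [<-]. Qed.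

Lemma base_point_tau u i : base_point u = Some i -> i \in tau.
Proof.
case/base_pointP => /label_block xu iu.
have [g] := block_connected xu iu iu.
exact: (cg_arc (relation_congruence x)).
Qed.

Lemma base_point_nonzero u i t :
  base_point u = Some i -> hue i t \notin relation x.
Proof. by case/base_pointP => /label_block xu; apply: block_nonzero. Qed.

Lemma base_point_inj u v i j g : base_point u = Some i ->
  base_point v = Some j -> arc i g j \in relation x -> u = v.
Proof.
case/base_pointP => us iu /base_pointP[vs jv] ij; apply: label_inj => //.
apply: (block_disjoint (i := j)) jv; try exact: label_block.
exact: block_closed (label_block us) iu ij.
Qed.

Lemma base_point_cover i : i \in tau -> (forall t, hue i t \notin relation x) ->
  exists u j g, base_point u = Some j /\ arc i g j \in relation x.
Proof.
move=> it iN; have [B xB iB] := block_cover it iN.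
have [u us uB] := label_surj xB; have := us.
rewrite base_point_dom; case uj: (base_point u) => [j|] // _.
have [_] := base_pointP uj; rewrite uB => jB.
by have [g ij] := block_connected xB iB jB; exists u, j, g.
Qed.

Lemma upset_iso : order_iso (upset x) (dowling to sigma).
Proof.
exact (upset_iso_pull base_point_dom base_point_tau base_point_nonzero
  base_point_inj base_point_cover).
Qed.

Section Segment.
Variables (y : dowling to tau) (xy : x <= y).
Variable s : {o : {set S} | o \in orbits to} -> S.
Hypothesis s_rep : forall o, s o \in val o.

Let y' : dowling to sigma := pull base_point_dom base_point_tau y.

(** A block of [x] is connected by arcs of [x], hence of [y], so a set closed under arcs of [y]
    contains it as soon as it contains its base point. *)
Let label_sub (A : {set T}) u i : base_point u = Some i ->
    (forall j k g, j \in A -> arc j g k \in relation y -> k \in A) ->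
  (label u \subset A) = (i \in A).
Proof.
move=> ui closedA; have [us iu] := base_pointP ui.
apply/subsetP/idP => [|iA j ju]; first exact.
have [g ij] := block_connected (label_block us) iu ju.
by apply: closedA iA _; apply: (subsetP _ _ ij); rewrite -dowling_leE.
Qed.

Let block_sub B u i : B \in underlying_partition y -> base_point u = Some i ->
  (u \in [set u in sigma | label u \subset B]) = (i \in B).
Proof.
move=> yB ui; have [us _] := base_pointP ui.
by rewrite inE us (label_sub ui) // => j k g; apply: block_closed.
Qed.

Let zero_sub (o : {o | o \in orbits to}) u i : base_point u = Some i ->
  (u \in [set u in sigma | label u \subset zero_preim y (val o)])
    = (i \in zero_preim y (val o)).
Proof.
move=> ui; have [us _] := base_pointP ui.
by rewrite inE us (label_sub ui) // => j k g; apply: zero_preim_closed.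
Qed.

Let base u : u \in sigma -> exists i, base_point u = Some i.
Proof. by rewrite base_point_dom; case: base_point => // i _; exists i. Qed.

Let block_base B u : B \in underlying_partition y ->
  u \in [set u in sigma | label u \subset B] ->
  exists2 i, base_point u = Some i & i \in B.
Proof.
move=> yB uB; have /base[i ui] : u \in sigma by move: uB; rewrite inE => /andP[].
by exists i; rewrite -?(block_sub yB ui).
Qed.

(** The interval is the lower interval of the restriction [y'] of [y] to base points, whose blocks
    and color classes consist of the labels of the blocks of [x] lying in those of [y]. *)
Lemma segment_iso :
  order_iso (segment x y)
    (fprod_poset (fun B : {B | B \in underlying_partition y} =>
              setpart [set u in sigma | label u \subset val B])
     *p fprod_poset (fun o : {o | o \in orbits to} =>
              dowling_lattice [subg 'C[s o | to]]%type
                [set u in sigma | label u \subset zero_preim y (val o)])).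
Proof.
apply: order_iso_trans (segment_iso_pull base_point_dom base_point_tau
  base_point_nonzero base_point_inj base_point_cover xy) _.
have yE : relation y' = pullset base_point (relation y) by apply: relation_decode.
apply: (downset_iso s_rep (e := y')); rewrite ?yE.
- move=> B u v /(block_base (valP B))[i ui iB] /(block_base (valP B))[j vj jB].
  have [g ij] := block_connected (valP B) iB jB.
  by exists g; apply/in_pullset_arc; exists i, j.
- move=> B u v g /(block_base (valP B))[i ui iB] /in_pullset_arc[i' [j [+ vj]]].
  rewrite ui => -[<-] ij; rewrite (block_sub (valP B) vj).
  exact: block_closed (valP B) iB ij.
- move=> B u t /(block_base (valP B))[i ui iB].
  apply/in_pullset_hue => -[j]; rewrite ui => -[<-].
  exact/negP/(block_nonzero t (valP B) iB).
- move=> u /base[i ui] uN; have [|B yB iB] := block_cover (base_point_tau ui) (y := y).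
    move=> t; apply: contra (uN t) => it.
    by apply/in_pullset_hue; exists i.
  exists (exist (fun B => B \in underlying_partition y) B yB).
  by rewrite (block_sub yB ui).
- move=> B B' u /(block_base (valP B))[i ui iB] /(block_base (valP B'))[j].
  rewrite ui => -[<-] iB'; apply: val_inj.
  exact: block_disjoint (valP B) (valP B') iB iB'.
- move=> o u; split=> [uo|[t to_ /in_pullset_hue[i ui it]]]; last first.
    by rewrite (zero_sub o ui); apply/in_zero_preim; exists t.
  have /base[i ui] : u \in sigma by move: uo; rewrite inE => /andP[].
  move: uo; rewrite (zero_sub o ui) => /in_zero_preim[t to_ it].
  by exists t => //; apply/in_pullset_hue; exists i.
Qed.

End Segment.
End Labels.
End MainIsomorphisms.

Theorem theorem2p15 (gT : finGroupType) (S : finType) (to : {action gT &-> S})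
    (s : {o : {set S} | o \in orbits to} -> S)
    (s_rep : forall o, s o \in val o) (n : nat) :
  [/\ forall y : dowling to [set: 'I_n],
        order_iso (downset y)
          (fprod_poset (fun B : {B | B \in underlying_partition y} =>
                    setpart (val B))
           *p fprod_poset (fun o : {o | o \in orbits to} =>
                    dowling_lattice [subg 'C[s o | to]]%type
                      (zero_preim y (val o)))),
      forall y : dowling to [set: 'I_n],
        order_iso (upset y) (dowling to (underlying_partition y)),
      forall x y : dowling to [set: 'I_n], x <= y ->
        order_iso (segment x y)
          (fprod_poset (fun B : {B | B \in underlying_partition y} =>
                    setpart [set A in blocks x | underlying A \subset val B])
           *p fprod_poset (fun o : {o | o \in orbits to} =>
                    dowling_lattice [subg 'C[s o | to]]%type
                      [set A in blocks x |
                         underlying A \subset zero_preim y (val o)])) &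
      forall x y : dowling to [set: 'I_n], x <= y ->
        geometric_lattice (segment x y)].
Proof.
split=> [y|y|x y xy|x y]; last exact: geometric_segment.
- apply: (downset_iso s_rep (e := y)).
  + by move=> B u v; apply: block_connected (valP B).
  + by move=> B u v g; apply: block_closed (valP B).
  + by move=> B u t; apply: block_nonzero (valP B).
  + move=> u ut uN; have [B yB uB] := block_cover ut uN.
    by exists (exist (fun B => B \in underlying_partition y) B yB).
  + by move=> B B' u uB uB'; apply: val_inj; apply: block_disjoint uB uB'; apply: valP.
  + by move=> o u; apply: in_zero_preim.
(* Here the blocks are labelled by their underlying sets; for the interval below, by their classes
   of colorings. *)
- by apply: (upset_iso (label := id)) => // B yB; exists B.
- apply: (segment_iso (label := @underlying _ _) _ _ _ xy s_rep).
  + by move=> bt xbt; apply: imset_f.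
  + have /andP[/and4P[_ /dinjectiveP inj _ _] _] := valP x.
    exact: inj.
  + by move=> B /imsetP[bt xbt ->]; exists bt.
Qed.
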